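(* Let $\mathbb{K}$ be a field finitely generated over $\mathbb{Q}$, let $\mathbb{F}$ be an algebraic closure of $\mathbb{K}$, and let $\alpha\in\mathbb{F}$ be algebraic of degree $n$ over $\mathbb{K}$. Let $\mathcal{C}\subseteq\mathbb{F}^N$ be a rational curve defined over $\mathbb{K}$, given by a birational parametrization $\phi$ with coefficients in $\mathbb{K}(\alpha)$. Let $\mathcal{U}$ be the one-dimensional component of the $\alpha$-witness variety of $\mathcal{C}$ (with respect to $\phi$) for the extension $\mathbb{K}\subseteq\mathbb{K}(\alpha)$. Suppose that the degree of $\mathcal{U}$ is $r<n$. Then $\mathcal{C}$ admits a reparametrization over a field $\mathbb{K}(\gamma)\subseteq\mathbb{K}(\alpha)$ with $[\mathbb{K}(\gamma):\mathbb{K}]=r$, and this reparametrization can be taken affine: there is $f_1t+f_2\in\mathbb{K}(\alpha)[t]$, $f_1\neq0$, such that all components of $\phi(f_1t+f_2)$ lie in $\mathbb{K}(\gamma)(t)$. Moreover, let $e_1,e_2\in\mathbb{F}$ be algebraic over $\mathbb{K}$ with $e_1\ne0$, let $\phi(e_1t+e_2)$ be another parametrization of $\mathcal{C}$, and let $\mathbb{L}$ be the field generated over $\mathbb{K}$ by the coefficients of $\phi(e_1t+e_2)$. Then: 1. $[\mathbb{L}:\mathbb{K}]\ge r$. 2. $\mathbb{L}$ contains (a field isomorphic to) $\mathbb{K}(\gamma)$. 3. If $[\mathbb{L}:\mathbb{K}]=r$, then $\mathbb{L}$ is isomorphic to $\mathbb{K}(\gamma)$. 4. There are $e_1',e_2'\in\mathbb{L}$,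 $e_1'\neq0$, such that $e_1't+e_2'$ reparametrizes $\phi$ over (a field isomorphic to) $\mathbb{K}(\gamma)$.
   Context: A curve $\mathcal{C}\subseteq\mathbb{F}^N$ is defined over $\mathbb{K}$ if its ideal in $\mathbb{F}[x_1,\dots,x_N]$ is generated by polynomials with coefficients in $\mathbb{K}$. A substitution $u(t)$ (a linear fraction of nonzero determinant) reparametrizes a parametrization $\phi$ over a field $\mathbb{M}$ if all components of $\phi(u(t))$ lie in $\mathbb{M}(t)$. The field generated over $\mathbb{K}$ by the coefficients of a parametrization means the smallest field $\mathbb{L}\supseteq\mathbb{K}$ such that all its components lie in $\mathbb{L}(t)$. Witness variety: let $\phi=(\phi_1,\dots,\phi_N)$, $\phi_j\in\mathbb{K}(\alpha)(t)$, be written as $\phi_j=f_j/g$ with $\gcd(f_1,\dots,f_N,g)=1$. Let $t_0,\dots,t_{n-1}$ be new variables and write $$\phi_j\Big(\sum_{i=0}^{n-1}\alpha^i t_i\Big)=\sum_{i=0}^{n-1}\alpha^i\psi_{ij}(t_0,\dots,t_{n-1}),\qquad \psi_{ij}=\frac{F_{ij}}{\delta}\in\mathbb{K}(t_0,\dots,t_{n-1}),$$ with $F_{ij},\delta\in\mathbb{K}[t_0,\dots,t_{n-1}]$ having no common factor (common denominator $\delta$ in lowest terms). The $\alpha$-witness variety of $\phi$ for $\mathbb{K}\subseteq\mathbb{K}(\alpha)$ is the Zariski closure $\mathcal{Z}\subseteq\mathbb{F}^n$ of $\{F_{ij}=0 \mid 1\le i\le n-1,\ 1\le j\le N\}\setminus\{\delta=0\}$.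 It is known that $\dim\mathcal{Z}\le 1$, that $\mathcal{Z}$ has at most one one-dimensional component, and that $\mathbb{K}$ is a field of definition of $\mathcal{C}$ if and only if $\dim\mathcal{Z}=1$. The degree of $\mathcal{U}$ is its geometric degree as a curve in $\mathbb{F}^n$.
   Formalization: In item 4, e_1't+e_2' is taken to reparametrize φ(e_1t+e_2), the parametrization over L, instead of φ itself; for φ itself the claim fails, e.g. K=Q, α=√2, φ=(αt,2t²), e_1=1/α, e_2=0, L=Q. *)

(* Defs.v *)
From HB Require Import structures.
From mathcomp Require Import all_boot all_order all_algebra.
From mathcomp Require Import boolp classical_sets functions cardinality.
From mathcomp Require Import mpoly.

Set Implicit Arguments.
Unset Strict Implicit.
Unset Printing Implicit Defensive.

Import GRing.Theory.
Local Open Scope classical_set_scope.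
Local Open Scope quotient_scope.
Local Open Scope ring_scope.

Notation "x %:F" := (@FracField.tofrac _ x) : ring_scope.

(* Every field occurring here is a subfield of one fixed field F (in the
   theorem, the algebraic closure of K), given as a set of elements of F. *)

Section Subfields.
Variable F : fieldType.
Implicit Types (K L M : set F).

Definition is_subfield M : Prop := GRing.divring_closed (mem M).

Definition adjoin K (a : F) : set F := smallest is_subfield (K `|` [set a]).

(* In characteristic 0 the smallest subfield containing s also contains the
   prime field Q, so this is Q(s). *)
Definition finitely_generated_over_Q K : Prop :=
  [pchar F] =i pred0 /\ exists s : seq F, K = smallest is_subfield [set` s].

Definition algebraic_over K (x : F) : Prop :=
  exists p : {poly F}, [/\ p \is a polyOver (mem K), p != 0 & root p x].

(* [L : K] = d, for K contained in L: L has a K-basis of d elements. *)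
Definition ext_degree K L (d : nat) : Prop :=
  exists b : 'I_d -> F, (forall i, L (b i)) /\
    forall x, L x -> exists! c : 'rV[F]_d,
      (forall i, K (c 0 i)) /\ x = \sum_(i < d) c 0 i * b i.

(* Isomorphism of extensions of K. *)
Definition isomorphic_over K M M' : Prop :=
  exists f : F -> F,
    [/\ set_bij M M' f,
        {in M &, {morph f : x y / x + y}},
        {in M &, {morph f : x y / x * y}}
      & {in K, f =1 id}].

End Subfields.

Section RationalFunctions.
Variable F : fieldType.

Definition ratfun_over (M : set F) (psi : {fraction {poly F}}) : Prop :=
  exists p q : {poly F},
    [/\ p \is a polyOver (mem M), q \is a polyOver (mem M), q != 0
      & psi = p%:F / q%:F].

(* The value h(psi)(u) of a rational function psi at an element u of an
   extension field h : F -> E.  It does not depend on the fraction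
   representing psi as soon as u is transcendental over h(F), see ratsubstE;
   this is the only case in which it is used. *)
Definition ratsubst (E : fieldType) (h : F -> E) (u : E)
    (psi : {fraction {poly F}}) : E :=
  (map_poly h \n_(repr psi)).[u] / (map_poly h \d_(repr psi)).[u].

Lemma ratsubstE (E : fieldType) (h : {rmorphism F -> E}) (u : E)
    (p q : {poly F}) :
  (forall s : {poly F}, s != 0 -> (map_poly h s).[u] != 0) -> q != 0 ->
  ratsubst h u (p%:F / q%:F) = (map_poly h p).[u] / (map_poly h q).[u].
Proof.
move=> tr q0; set x := _ / _.
have d0 : \d_(repr x) != 0 by exact: denom_ratioP.
have ex : x = (\n_(repr x))%:F / (\d_(repr x))%:F.
  apply: (canRL (mulfK _)); first by rewrite tofrac_eq0.
  rewrite -{1}[x]reprK; move: d0; case: (repr x) => -[a b] /= b0 _.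
  unlock FracField.tofrac.
  rewrite -[LHS]FracField.pi_mul; apply/eqmodP => /=.
  by rewrite FracField.equivfE /FracField.mulf !numden_Ratio ?oner_neq0 ?mulr1
             //= mulrC.
move: ex; rewrite /x => /eqP.
rewrite eqr_div ?tofrac_eq0 // -!tofracM tofrac_eq => /eqP e.
apply/eqP; rewrite /ratsubst eqr_div ?tr // -!hornerM -!rmorphM /=.
by rewrite e.
Qed.

Definition affine_sub (a b : F) : {fraction {poly F}} := (a *: 'X + b%:P)%:F.

(* Parametrizations are N-tuples of elements of F(t). *)

Definition reparam N (phi : 'I_N -> {fraction {poly F}})
    (u : {fraction {poly F}}) : 'I_N -> {fraction {poly F}} :=
  fun j => ratsubst (fun c => (c%:P)%:F) u (phi j).

Definition coef_field (K : set F) N (phi : 'I_N -> {fraction {poly F}}) :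
    set F :=
  smallest (fun M => is_subfield M /\ forall j, ratfun_over M (phi j)) K.

End RationalFunctions.

Section AffineGeometry.
Variable F : fieldType.

Definition vanishing_ideal n (S : set 'rV[F]_n) : set {mpoly F[n]} :=
  [set p | forall x, S x -> p.@[x 0] = 0].

Definition zero_locus n (P : set {mpoly F[n]}) : set 'rV[F]_n :=
  [set x | forall p, P p -> p.@[x 0] = 0].

Definition zariski_closure n (S : set 'rV[F]_n) : set 'rV[F]_n :=
  zero_locus (vanishing_ideal S).

Definition zariski_closed n (S : set 'rV[F]_n) : Prop :=
  exists P, S = zero_locus P.

Definition irreducible_closed n (X : set 'rV[F]_n) : Prop :=
  [/\ zariski_closed X, X !=set0
    & forall A B, zariski_closed A -> zariski_closed B ->
        X `<=` A `|` B -> X `<=` A \/ X `<=` B].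

Definition irreducible_component n (Z X : set 'rV[F]_n) : Prop :=
  [/\ irreducible_closed X, X `<=` Z
    & forall Y, irreducible_closed Y -> Y `<=` Z -> X `<=` Y -> Y = X].

Definition irreducible_chain n (Z : set 'rV[F]_n) (d : nat) : Prop :=
  exists X : nat -> set 'rV[F]_n,
    (forall i, (i <= d)%N -> irreducible_closed (X i) /\ X i `<=` Z) /\
    (forall i, (i < d)%N -> X i `<` X i.+1).

(* Krull dimension. *)
Definition has_dim n (Z : set 'rV[F]_n) (d : nat) : Prop :=
  irreducible_chain Z d /\ ~ irreducible_chain Z d.+1.

(* Geometric degree of a curve: it meets the generic hyperplane
   h_1 x_1 + ... + h_n x_n = h_0 in exactly r points, generic meaning outside
   of the zero locus of some nonzero polynomial D in h_0, ..., h_n. *)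
Definition curve_degree n (X : set 'rV[F]_n) (r : nat) : Prop :=
  exists D : {mpoly F[n.+1]}, D != 0 /\
    forall h : 'rV[F]_n.+1, D.@[h 0] != 0 ->
      (X `&` [set x | \sum_(i < n) h 0 (lift ord0 i) * x 0 i = h 0 ord0]
         #= `I_r)%card.

Definition generated_ideal n (G : set {mpoly F[n]}) : set {mpoly F[n]} :=
  [set p | exists s : seq ({mpoly F[n]} * {mpoly F[n]}),
     (forall w, w \in s -> G w.2) /\ p = \sum_(w <- s) w.1 * w.2].

Definition defined_over (K : set F) n (C : set 'rV[F]_n) : Prop :=
  exists G : set {mpoly F[n]},
    (forall p, G p -> p \is a mpolyOver n (mem K)) /\
    vanishing_ideal C = generated_ideal G.

(* psi is defined at t and takes there the value y. *)
Definition value_at (psi : {fraction {poly F}}) (t y : F) : Prop :=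
  exists p q : {poly F},
    [/\ psi = p%:F / q%:F, q.[t] != 0 & y = p.[t] / q.[t]].

Definition param_image N (phi : 'I_N -> {fraction {poly F}}) :
    set 'rV[F]_N :=
  [set x | exists t, forall j, value_at (phi j) t (x 0 j)].

(* phi is a dominant rational map from the line to C, and it has a rational
   inverse P / Q: Q does not vanish identically on C and P(phi)/Q(phi) = t. *)
Definition birational_parametrization N (phi : 'I_N -> {fraction {poly F}})
    (C : set 'rV[F]_N) : Prop :=
  C = zariski_closure (param_image phi) /\
  exists P Q : {mpoly F[N]},
    let at_phi (p : {mpoly F[N]}) := mmap (fun c : F => (c%:P)%:F) phi p in
    at_phi Q != 0 /\ at_phi P / at_phi Q = 'X%:F.

(* No nonconstant polynomial over K divides all elements of P in
   K[t_0, ..., t_(n-1)]. *)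
Definition no_common_factor (K : set F) n (P : set {mpoly F[n]}) : Prop :=
  forall d : {mpoly F[n]}, d \is a mpolyOver n (mem K) ->
    (forall p, P p -> exists2 q, q \is a mpolyOver n (mem K) & p = q * d) ->
    (msize d <= 1)%N.

(* With t = \sum_i alpha^i t_i, phi_j(t) = \sum_i alpha^i psi_ij, where the
   num i j / delta are the psi_ij over their reduced common denominator. *)
Definition witness_variety (K : set F) (n : nat) (alpha : F) N
    (phi : 'I_N -> {fraction {poly F}}) (Z : set 'rV[F]_n) : Prop :=
  exists (num : 'I_n -> 'I_N -> {mpoly F[n]}) (delta : {mpoly F[n]}),
    [/\ (forall i j, num i j \is a mpolyOver n (mem K))
          /\ delta \is a mpolyOver n (mem K),
        delta != 0
          /\ no_common_factor K
               ([set delta] `|` [set p | exists i j, p = num i j]),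
        forall j,
          ratsubst (fun c => (c%:MP_[n])%:F)
            (\sum_(i < n) alpha ^+ i *: 'X_i)%:F (phi j)
          = \sum_(i < n)
              ((alpha ^+ i)%:MP_[n])%:F * ((num i j)%:F / delta%:F)
      & Z = zariski_closure
              [set x | (forall (i : 'I_n) j, (0 < i)%N -> (num i j).@[x 0] = 0)
                       /\ delta.@[x 0] != 0]].

End AffineGeometry.

(* Main.v *)
Require Import Defs.
From HB Require Import structures.
From mathcomp Require Import all_boot all_order all_algebra.
From mathcomp Require Import boolp classical_sets functions cardinality.
From mathcomp Require Import mpoly separable zify ring.

Set Implicit Arguments.
Unset Strict Implicit.
Unset Printing Implicit Defensive.

Import GRing.Theory.
Local Open Scope classical_set_scope.
Local Open Scope ring_scope.

(** Let G be the group of automorphisms of F over K.  Since C is defined over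
    K, every conjugate of phi parametrizes C birationally too, so for g in G
    there is a Moebius transformation v_g with phi^g (v_g (t)) = phi (t), and
    v_(gh) = (v_h)^g o v_g.  If alpha_1, ..., alpha_n are the conjugates of
    alpha, with g_i alpha = alpha_i, then in the coordinates
    s_i = \sum_k alpha_i^k x_k a point is a witness exactly when the phi^(g_i)
    (s_i) agree, hence U is the curve t |-> (v_(g_i) (t))_i.  A hyperplane cuts
    on it a rational function of t whose degree is the number of distinct
    poles of the v_(g_i); this is therefore r.

    The automorphisms g for which v_g is affine form the stabilizer of the pole
    at infinity under G, a subgroup of index r, whose fixed field is K(gamma).
    On this subgroup v is a cocycle with values in the affine group; it is
    trivialized by averaging (Hilbert 90), and the trivialization is the affine
    substitution f_1 t + f_2.  If phi (e_1 t + e_2) has coefficients in L, then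
    every automorphism fixing L has an affine v_g, whence K(gamma) is contained
    in L, and the same averaging over the conjugates of a primitive element of
    L descends from L to K(gamma).

    The automorphisms of F are obtained by Zorn's lemma from the partial ones,
    represented by their graphs.  Properties of all but finitely many parameters
    are expressed by a nonzero polynomial outside of whose zeros they hold. *)

(** * Automorphisms over a subfield *)

(** Three links are left implicit above. First, [v_g] and [v_h] have the same pole exactly when
    [v_h o v_g^-1] is affine, and by the cocycle relation this map is the conjugate under [g] of
    [v_(g^-1 h)]. As [v_1] is the identity, the distinct poles of the [v_(g_i)] correspond to the
    cosets of the stabilizer of infinity. This is why a geometric degree, a count of poles, is also
    the degree of K(gamma) over K. Secondly, poles may cancel in a hyperplane section: several
    [v_(g_i)] can share a pole, and the section only sees the sum of their residues weighted by its
    coefficients. For generic coefficients no such sum vanishes. The passage to the coordinates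
    [s_i] is an invertible Vandermonde map, so it loses no hyperplane. Thirdly, gamma is not
    computed from U. The conjugates of alpha are grouped by pole, and gamma is the value at a
    suitable integer of the monic polynomial whose roots are the conjugates grouped with alpha
    itself. K(gamma) then lies inside F, even inside L, so the isomorphisms of the statement can all
    be taken to be identities. *)

Section SubfieldTheory.
Variables (F : fieldType) (K : set F).
Hypothesis subK : is_subfield K.

Lemma subfield1 : K 1.
Proof. by have [K1 _ _] := subK; apply: set_mem. Qed.

Lemma subfieldB x y : K x -> K y -> K (x - y).
Proof.
have [_ KB _] := subK => Kx Ky.
by apply/set_mem/KB; apply: mem_set.
Qed.

Lemma subfield_div x y : K x -> K y -> K (x / y).
Proof.
have [_ _ KV] := subK => Kx Ky.
by apply/set_mem/KV; apply: mem_set.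
Qed.

Lemma subfield0 : K 0.
Proof. by rewrite -(subrr 1); apply: subfieldB subfield1 subfield1. Qed.

Lemma subfieldN x : K x -> K (- x).
Proof. by move=> Kx; rewrite -sub0r; apply: subfieldB subfield0 Kx. Qed.

Lemma subfieldD x y : K x -> K y -> K (x + y).
Proof.
by move=> Kx Ky; rewrite -[y]opprK; apply: subfieldB => //; apply: subfieldN.
Qed.

Lemma subfieldV x : K x -> K x^-1.
Proof. by move=> Kx; rewrite -div1r; apply: subfield_div subfield1 Kx. Qed.

Lemma subfieldM x y : K x -> K y -> K (x * y).
Proof.
by move=> Kx Ky; rewrite -[y]invrK; apply: subfield_div => //; apply: subfieldV.
Qed.

Lemma subfieldX x n : K x -> K (x ^+ n).
Proof.
move=> Kx; elim: n => [|n IHn]; first by rewrite expr0; apply: subfield1.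
by rewrite exprS; apply: subfieldM.
Qed.

Lemma subfield_nat n : K n%:R.
Proof.
elim: n => [|n IHn]; first exact: subfield0.
by rewrite -addn1 natrD; apply: subfieldD IHn subfield1.
Qed.

Lemma subfield_sum (I : Type) (s : seq I) (P : pred I) (f : I -> F) :
  (forall i, P i -> K (f i)) -> K (\sum_(i <- s | P i) f i).
Proof. by move=> Kf; elim/big_ind: _ => //; [exact: subfield0|exact: subfieldD]. Qed.

Lemma polyOver_subfield (p : {poly F}) : p \is a polyOver (mem K) <-> forall i, K p`_i.
Proof.
split=> [/allP pK i|pK].
  have [lt|le] := ltnP i (size p); first by apply/set_mem/pK/mem_nth.
  by rewrite nth_default //; apply: subfield0.
by apply/(all_nthP 0) => i _; apply/mem_set.
Qed.

End SubfieldTheory.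

(** * Extension of isomorphisms between subfields to endomorphisms of F *)

Section PartialIsomorphisms.
Variable F : fieldType.

(* The graph of an isomorphism between two subfields of F, as a subring of
   F * F: the condition on zeros makes every nonzero element invertible there
   and makes the relation functional in both directions. *)
Record partial_iso := PartialIso {
  graph :> set (F * F);
  graph_divring : GRing.divring_closed (mem graph);
  graph_eq0 : forall u, graph u -> (u.1 == 0) = (u.2 == 0) }.

Variable G : partial_iso.

Definition in_graph (u : F * F) : bool := u \in graph G.

HB.instance Definition _ :=
  GRing.isDivringClosed.Build (F * F)%type in_graph (graph_divring G).

Definition graph_field := {u | in_graph u}.

HB.instance Definition _ := SubType.on graph_field.
HB.instance Definition _ := [Choice of graph_field by <:].
HB.instance Definition _ := [SubChoice_isSubComUnitRing of graph_field by <:].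

Fact graph_fieldP : GRing.field_axiom graph_field.
Proof.
move=> u u0; have [u10 u20] : (val u).1 != 0 /\ (val u).2 != 0.
  have e := graph_eq0 (set_mem (valP u : in_graph _)).
  suff u1 : (val u).1 != 0 by rewrite -e.
  apply: contra u0 => u1; apply/eqP/val_inj.
  by move: u1 (u1); rewrite {1}e; case: (val u) => a b /= /eqP-> /eqP->.
have U : val u \is a GRing.unit by rewrite /in_mem /= !unitfE u10 u20.
by rewrite unitrE; apply/eqP/val_inj; rewrite rmorph1 rmorphM /= divrr.
Qed.

HB.instance Definition _ := GRing.ComUnitRing_isField.Build graph_field graph_fieldP.

Definition gleft : graph_field -> F := fst \o val.
HB.instance Definition _ := GRing.RMorphism.on gleft.
Definition gright : graph_field -> F := snd \o val.
HB.instance Definition _ := GRing.RMorphism.on gright.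

Variables (p : {poly graph_field}) (x y : F).
Hypothesis p0 : p != 0.
Hypothesis px : root (map_poly gleft p) x.
Hypothesis p_min : forall q : {poly graph_field},
  q != 0 -> root (map_poly gleft q) x -> (size p <= size q)%N.
Hypothesis py : root (map_poly gright p) y.

Lemma root_minimal (q : {poly graph_field}) :
  root (map_poly gleft q) x -> p %| q.
Proof.
move=> qx; rewrite /dvdp; apply: contraT => r0.
suff /(p_min r0) : root (map_poly gleft (q %% p)) x.
  by rewrite leqNgt ltn_modp p0.
move: qx; rewrite {1}(divp_eq q p) rmorphD rmorphM /= /root hornerD hornerM.
by rewrite (rootP px) mulr0 add0r.
Qed.

(** Least degree makes [p] irreducible: a nontrivial common factor of [p] and [q] does not vanish at
    [x], so its cofactor in [p] would vanish there with a smaller degree. *)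
Lemma coprime_minimal (q : {poly graph_field}) :
  ~~ root (map_poly gleft q) x -> coprimep p q.
Proof.
move=> qx; apply: contraT; set d := gcdp p q => dn1.
have dx : ~~ root (map_poly gleft d) x.
  apply: contra qx; rewrite -!dvdp_XsubCl => /dvdp_trans; apply.
  by rewrite dvdp_map dvdp_gcdr.
have /dvdpP[e pE] : d %| p by apply: dvdp_gcdl.
have ex : root (map_poly gleft e) x.
  move: px; rewrite pE rmorphM /= rootM => /orP[] // dx'.
  by rewrite dx' in dx.
have d0 : d != 0 by rewrite gcdp_eq0 (negPf p0).
have e0 : e != 0 by apply: contraNneq p0 => e0; rewrite pE e0 mul0r.
have := p_min e0 ex; rewrite pE size_mul // => le.
have d1 : (1 < size d)%N by rewrite ltn_neqAle eq_sym dn1 size_poly_gt0.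
have e1 : (0 < size e)%N by rewrite size_poly_gt0.
by move: le d1 e1; clearbody d; move: (size e) (size d) => m k; case: k => [|[|k]] //;
  rewrite !addnS /= leqNgt ltnS leq_addr.
Qed.

(** If [q] vanishes at [x], it is a multiple of [p]. Otherwise it is coprime to [p], and coprimality
    persists on the right-hand side, where it excludes a common root [y]. *)
Lemma root_minimalE (q : {poly graph_field}) :
  root (map_poly gleft q) x = root (map_poly gright q) y.
Proof.
apply/idP/idP => [/root_minimal/dvdpP[e ->]|qy].
  by rewrite rmorphM /= rootM py orbT.
apply: contraT => /coprime_minimal cpq.
have : coprimep (map_poly gright p) (map_poly gright q) by rewrite coprimep_map.
by move/coprimep_root => /(_ _ py); rewrite (rootP qy) eqxx.
Qed.

(** The new graph consists of the pairs of values of one polynomial over the old graph, with left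
    coefficients at [x] and right coefficients at [y]. The two values vanish together because [p] is
    minimal. *)
Lemma partial_iso_adjoin : exists G' : partial_iso,
  graph G `<=` graph G' /\ graph G' (x, y).
Proof.
pose ev (q : {poly graph_field}) := ((map_poly gleft q).[x], (map_poly gright q).[y]).
have evB q q' : ev (q - q') = ev q - ev q'.
  by rewrite /ev !rmorphB !hornerD !hornerN.
have evD q q' : ev (q + q') = ev q + ev q'.
  by rewrite /ev !rmorphD !hornerD.
have evM q q' : ev (q * q') = ev q * ev q'.
  by rewrite /ev !rmorphM !hornerM.
have ev1 : ev 1 = 1 by rewrite /ev !rmorph1 !hornerC.
have ev0 q : ((ev q).1 == 0) = ((ev q).2 == 0) by apply: root_minimalE.
have evV q : exists q', ev q' = (ev q)^-1.
  have [/eqP q0|q0] := boolP ((ev q).1 == 0).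
    have q0' : (ev q).2 = 0 by apply/eqP; rewrite -ev0 q0.
    have -> : ev q = 0 by rewrite [LHS]surjective_pairing q0 q0'.
    by exists 0; rewrite invr0 /ev !rmorph0 !hornerC.
  (* The Bezout relation between [p] and [q] evaluates to [ev b * ev q = 1], since [ev p = 0]. *)
  have /Bezout_eq1_coprimepP[[a b] /= ab] := coprime_minimal q0.
  have U : ev q \is a GRing.unit.
    by rewrite unfold_in /= !unitfE; move: q0; rewrite /ev /= (ev0 q) => ->.
  exists b; apply: (mulIr U); rewrite mulVr // -evM -ev1 -ab evD (evM a).
  suff -> : ev p = 0 by rewrite mulr0 add0r.
  by rewrite /ev (rootP px) (rootP py).
have graphD : GRing.divring_closed (mem (range ev)).
  split=> [|u v|u v]; first by apply/mem_set; exists 1.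
    move=> /set_mem[q _ <-] /set_mem[q' _ <-].
    by apply/mem_set; exists (q - q').
  move=> /set_mem[q _ <-] /set_mem[q' _ <-].
  have [q'' E] := evV q'; rewrite -E -evM.
  by apply/mem_set; exists (q * q'').
have graph0 u : range ev u -> (u.1 == 0) = (u.2 == 0) by case=> q _ <-.
exists (PartialIso graphD graph0); split=> [u Gu|] /=.
  exists (Sub u (mem_set Gu) : graph_field)%:P => //.
  by rewrite /ev !map_polyC !hornerC /= /gleft /gright /= -surjective_pairing.
by exists 'X => //; rewrite /ev !map_polyX !hornerX.
Qed.

End PartialIsomorphisms.

Lemma rmorphism_of (R S : nzRingType) (f : R -> S) :
  {morph f : x y / x - y} -> {morph f : x y / x * y} -> f 1 = 1 ->
  exists g : {rmorphism R -> S}, g =1 f.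
Proof.
move=> fB fM f1; pose fZ := GRing.isZmodMorphism.Build R S f fB.
pose f_mon := GRing.isMonoidMorphism.Build R S f (conj f1 fM).
pose g : GRing.RMorphism.type R S := HB.pack f fZ f_mon.
by exists g.
Qed.

Lemma partial_iso_total (F : fieldType) (G : partial_iso F) :
  (forall x, exists y, graph G (x, y)) ->
  exists g : {rmorphism F -> F}, forall x y, graph G (x, y) -> y = g x.
Proof.
move=> /choice[f fG].
have [G1 GB GV] := graph_divring G.
have GM := GRing.divring_closedBM (graph_divring G).
have inj x y y' : graph G (x, y) -> graph G (x, y') -> y = y'.
  move=> /mem_set h /mem_set h'; apply/eqP; rewrite -subr_eq0.
  by rewrite -(graph_eq0 (set_mem (GB _ _ h h'))) /= subrr.
have mfG x : (x, f x) \in mem (graph G) by apply/mem_set/fG.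
have [|||g gE] := @rmorphism_of F F f.
- by move=> x y; apply: inj (fG _) (set_mem (GB _ _ (mfG x) (mfG y))).
- by case: GM => _ _ GM x y; apply: inj (fG _) (set_mem (GM _ _ (mfG x) (mfG y))).
- exact: inj (fG _) (set_mem G1).
by exists g => x y /(inj _ _ _ (fG x)) <-.
Qed.

(** A maximal graph above [G0] has all of F as domain: the minimal polynomial of a missing [x],
    transported to the right-hand side, has a root [y] because F is algebraically closed, and the
    pair [(x, y)] could be adjoined. Surjectivity is not sought here; over an algebraic extension it
    follows in [fixes_inv]. *)
Lemma partial_iso_extend (F : closedFieldType) (G0 : partial_iso F) :
  (forall x, exists2 p : {poly graph_field G0},
     p != 0 & root (map_poly (@gleft _ G0) p) x) ->
  exists g : {rmorphism F -> F}, forall u, graph G0 u -> u.2 = g u.1.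
Proof.
move=> alg.
pose is_iso (S : set (F * F)) := GRing.divring_closed (mem S) /\
  forall u, S u -> (u.1 == 0) = (u.2 == 0).
(* The union with the graph of G0 makes the property hold for the empty chain. *)
have [|A [[GD G0'] Amax]] := @Zorn_bigcup _ [set S | is_iso (S `|` graph G0)].
  move=> C CP Ctot; set W := \bigcup_(X in C) X.
  have WE u v : (W `|` graph G0) u -> (W `|` graph G0) v ->
      exists S, [/\ is_iso S, S `<=` W `|` graph G0, S u & S v].
    have iG : is_iso (graph G0) by split; [exact: graph_divring|exact: graph_eq0].
    have sX X : C X -> X `|` graph G0 `<=` W `|` G0.
      by move=> CX w [Xw|]; [left; exists X|right].
    case=> [[X CX Xu]|Gu] [[Y CY Yv]|Gv].
    - case: (Ctot _ _ CX CY) => XY.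
        by exists (Y `|` graph G0); split; [exact: CP|exact: sX|left; apply: XY|left].
      by exists (X `|` graph G0); split; [exact: CP|exact: sX|left|left; apply: XY].
    - by exists (X `|` graph G0); split; [exact: CP|exact: sX|left|right].
    - by exists (Y `|` graph G0); split; [exact: CP|exact: sX|right|left].
    - by exists (graph G0); split=> // w; right.
  split; last by move=> u Wu; have [S [[_ S0] _ Su _]] := WE u u Wu Wu; apply: S0.
  have [G1 _ _] := graph_divring G0.
  split=> [|u v /set_mem Wu /set_mem Wv|u v /set_mem Wu /set_mem Wv].
  - by apply/mem_set; right; apply: set_mem G1.
  - have [S [[[_ SB _] _] SW Su Sv]] := WE u v Wu Wv.
    by apply/mem_set/SW/set_mem/SB; apply: mem_set.
  - have [S [[[_ _ SV] _] SW Su Sv]] := WE u v Wu Wv.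
    by apply/mem_set/SW/set_mem/SV; apply: mem_set.
pose G := PartialIso GD G0'.
have G0G : graph G0 `<=` graph G by move=> u; right.
suff /partial_iso_total[g gE] : forall x, exists y, graph G (x, y).
  by exists g => -[x y] /G0G /gE.
move=> x; have [p1 p10 p1x] := alg x.
pose incl (u : graph_field G0) : graph_field G :=
  Sub (val u) (mem_set (G0G _ (set_mem (valP u)))).
have [|||incl' inclE] := @rmorphism_of _ _ incl.
- by move=> u v; apply: val_inj.
- by move=> u v; apply: val_inj.
- exact: val_inj.
pose Q (q : {poly graph_field G}) := (q != 0) && root (map_poly (@gleft _ G) q) x.
have [|n /asboolP[p [/andP[p0 px] <-]] p_min] :=
  @ex_minnP (fun n => `[< exists q, Q q /\ size q = n >]).
  exists (size (map_poly incl' p1)); apply/asboolP; exists (map_poly incl' p1).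
  split=> //; rewrite /Q map_poly_eq0 p10 -map_poly_comp.
  by rewrite (eq_map_poly (g := @gleft _ G0)) // => u /=; rewrite inclE.
have pn1 : size (map_poly (@gright _ G) p) != 1%N.
  rewrite size_map_poly; apply: contraTneq px => /eqP/size_poly1P[c c0 ->].
  by rewrite map_polyC rootC fmorph_eq0.
have /closed_rootP[y py] := pn1.
have [|G' [GG' G'xy]] := partial_iso_adjoin p0 px _ py.
  move=> q q0 qx; apply: p_min; apply/asboolP; exists q; split=> //.
  by rewrite /Q q0.
have G'U : graph G' `|` graph G0 = graph G'.
  by apply/setUidPl => u /G0G/GG'.
exists y; apply/not_notP => nGxy; apply: (Amax (graph G')).
  split=> [|/(_ _ G'xy) Axy]; last by apply: nGxy; left.
  by move=> u Au; apply: GG'; left.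
suff : is_iso (graph G' `|` graph G0) by [].
by rewrite G'U; split; [exact: graph_divring|exact: graph_eq0].
Qed.

Definition fixes (F : fieldType) (K : set F) (g : F -> F) := forall x, K x -> g x = x.

Lemma poly_over_diagonal (F : fieldType) (K : set F) (G : partial_iso F) (p : {poly F})
  :
  is_subfield K -> (forall a, K a -> graph G (a, a)) -> p \is a polyOver (mem K) ->
  exists q : {poly graph_field G},
    map_poly (@gleft _ G) q = p /\ map_poly (@gright _ G) q = p.
Proof.
move=> subK KG /(polyOver_subfield subK) pK.
pose q : {poly graph_field G} := \poly_(i < size p)
  (Sub (p`_i, p`_i) (mem_set (KG _ (pK i))) : graph_field G).
exists q; split; apply/polyP=> i; rewrite coef_map coef_poly;
  by case: ltnP => [//|le]; rewrite nth_default.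
Qed.

Lemma deriv_neq0 (R : idomainType) (p : {poly R}) :
  [pchar R] =i pred0 -> (1 < size p)%N -> p^`() != 0.
Proof.
move=> /pcharf0P ch p1; apply: contraTneq p1 => dp.
have /eqP : p^`()`_(size p).-2 = 0 by rewrite dp coef0.
rewrite coef_deriv -mulr_natr mulf_eq0 ch.
case E : (size p) => [|[|m]] //=; rewrite orbF => /eqP pm.
by have := lead_coef_eq0 p; rewrite lead_coefE E /= pm eqxx -size_poly_eq0 E.
Qed.

Section FixedField.
Variables (F : closedFieldType) (K : set F).
Hypothesis char0 : [pchar F] =i pred0.
Hypothesis subK : is_subfield K.
Hypothesis algK : forall x : F, algebraic_over K x.

Let diag : set (F * F) := [set u | K u.1 /\ u.1 = u.2].

Fact diag_divring : GRing.divring_closed (mem diag).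
Proof.
split=> [|[u _] [v _] /set_mem[/= Ku <-] /set_mem[/= Kv <-]|
          [u _] [v _] /set_mem[/= Ku <-] /set_mem[/= Kv <-]]; apply/mem_set.
- by split=> //; apply: subfield1.
- by split=> //; apply: subfieldB.
have -> : (v, v)^-1 = (v^-1, v^-1) :> F * F.
  have [-> /=|v0] := eqVneq v 0; first by rewrite !invr0.
  apply: (mulrI (x := (v, v))); first by rewrite unfold_in /= !unitfE v0.
  by rewrite divrr; [congr pair; rewrite /= mulfV|rewrite unfold_in /= !unitfE v0].
by split=> //; apply: subfield_div.
Qed.

Let Gdiag : partial_iso F.
Proof. by apply: (PartialIso diag_divring) => -[a b] [/= _ ->]. Defined.

(** The minimal polynomial of [x] over K is [e] times [X - x], and [e] does not vanish at [x], for
    otherwise the derivative would be a smaller nonzero polynomial with root [x]. Either [e] is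
    constant and [x] is in K, or [e] has a root [y] other than [x], and the isomorphism over K
    sending [x] to [y] extends to F. *)
Lemma fixed_by_automorphisms x :
  (forall g : {rmorphism F -> F}, fixes K g -> g x = x) -> K x.
Proof.
move=> fix_x; have [p1 [p1K p10 p1x]] := algK x.
have KG a : K a -> graph Gdiag (a, a) by [].
have lr : @gright _ Gdiag =1 @gleft _ Gdiag.
  by move=> u; have [_ /esym] := set_mem (valP u : in_graph _ _).
pose Q (q : {poly graph_field Gdiag}) := (q != 0) && root (map_poly (@gleft _ Gdiag) q)
  x.
have [|n /asboolP[p [/andP[p0 px] <-]] p_min'] :=
    @ex_minnP (fun n => `[< exists q, Q q /\ size q = n >]).
  have [q [qE _]] := poly_over_diagonal subK KG p1K.
  exists (size q); apply/asboolP; exists q; rewrite /Q qE p1x andbT.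
  by split=> //; move: p10; rewrite -qE map_poly_eq0.
have {}p_min q : q != 0 -> root (map_poly (@gleft _ Gdiag) q) x -> (size p <= size q)%N.
  by move=> q0 qx; apply: p_min'; apply/asboolP; exists q; rewrite /Q q0.
have /factor_theorem[e eE] := px.
have e0 : e != 0.
  by apply: contraNneq p0 => e0; move/eqP: eE; rewrite e0 mul0r map_poly_eq0.
have sz : size p = (size e).+1.
  by rewrite -(size_map_poly (@gleft _ Gdiag)) eE size_Mmonic ?monicXsubC // size_XsubC
    addn2.
have charG : [pchar (graph_field Gdiag)] =i pred0.
  by move=> k; rewrite -char0 (fmorph_pchar (@gleft _ Gdiag)).
have ex : ~~ root e x.
  apply/negP=> ex; have : (1 < size p)%N by rewrite sz ltnS size_poly_gt0.
  move=> /[dup] p_gt1 /(deriv_neq0 charG) /p_min.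
  rewrite leqNgt lt_size_deriv // => /(_ _)/negP[] => //.
  rewrite -deriv_map eE derivM rootE hornerD !hornerM (rootP ex).
  by rewrite mul0r addr0 hornerXsubC subrr mulr0.
have [/size_poly1P[c c0 ec]|/closed_rootP[y ey]] := boolP (size e == 1%N).
  have cE : K c.
    have -> : c = (@gleft _ Gdiag) p`_1.
      by rewrite -coef_map eE ec coefCM coefB coefX coefC subr0 mulr1.
    by case: (set_mem (valP p`_1 : in_graph _ _)).
  have cxE : K (- (c * x)).
    have -> : - (c * x) = (@gleft _ Gdiag) p`_0.
      by rewrite -coef_map eE ec coefCM coefB coefX coefC sub0r mulrN.
    by case: (set_mem (valP p`_0 : in_graph _ _)).
  have -> : x = (- - (c * x)) / c by rewrite opprK mulrC mulKf.
  by apply: subfield_div => //; apply: subfieldN.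
have py : root (map_poly (@gright _ Gdiag) p) y.
  by rewrite (eq_map_poly lr) eE rootM ey.
have [G [GG Gxy]] := partial_iso_adjoin p0 px p_min py.
have [|g gE] := @partial_iso_extend _ G.
  move=> z; have [p2 [p2K p20 p2z]] := algK z.
  have [a Ka|q [qE _]] := @poly_over_diagonal _ K G p2 subK _ p2K; first exact/GG/KG.
  by exists q; [move: p20; rewrite -qE map_poly_eq0|rewrite qE].
have : g x = x by apply: fix_x => a Ka; rewrite -(gE (a, a)) //; exact/GG/KG.
by rewrite -(gE (x, y)) //= => yx; rewrite -yx ey in ex.
Qed.

End FixedField.

Section Automorphisms.
Variables (F : closedFieldType) (K : set F).
Hypothesis char0 : [pchar F] =i pred0.
Hypothesis subK : is_subfield K.
Hypothesis algK : forall x : F, algebraic_over K x.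

Lemma fixes_map_poly (g : {rmorphism F -> F}) (p : {poly F}) :
  fixes K g -> p \is a polyOver (mem K) -> map_poly g p = p.
Proof.
move=> gK /(polyOver_subfield subK) pK; apply/polyP => i.
by rewrite coef_map; apply: gK.
Qed.

Lemma algebraic_roots (x : F) : exists r : seq F,
  [/\ uniq r, x \in r & forall g : {rmorphism F -> F}, fixes K g ->
      forall y, y \in r -> g y \in r].
Proof.
have [p [pK p0 px]] := algK x; have [r pE] := closed_field_poly_normal p.
have rE y : (y \in undup r) = root p y.
  by rewrite mem_undup pE rootZ ?lead_coef_eq0 // root_prod_XsubC.
exists (undup r); rewrite undup_uniq rE; split=> // g gK y; rewrite !rE => py.
by rewrite -(fixes_map_poly gK pK) rmorph_root.
Qed.

(** An injective self-map of the finite set of roots around [y] is onto. Hence the ring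
    endomorphisms of F over K already form the group G, and the type of ring morphisms suffices to
    represent it. *)
Lemma fixes_inv (g : {rmorphism F -> F}) : fixes K g ->
  exists h : {rmorphism F -> F}, [/\ fixes K h, cancel g h & cancel h g].
Proof.
move=> gK; have surj y : exists x, g x = y.
  have [r [r_uniq yr gr]] := algebraic_roots y.
  have [|||_ E] := @uniq_min_size _ (map g r) r.
  - by rewrite map_inj_uniq //; apply: fmorph_inj.
  - by move=> _ /mapP[z zr ->]; apply: gr.
  - by rewrite size_map.
  by move: yr; rewrite -E => /mapP[x _ ->]; exists x.
have [f fK] := choice surj.
have gf : cancel g f by move=> x; apply: (fmorph_inj g); rewrite fK.
have [|||h hE] := @rmorphism_of _ _ f.
- by move=> x y; apply: (fmorph_inj g); rewrite rmorphB !fK.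
- by move=> x y; apply: (fmorph_inj g); rewrite rmorphM !fK.
- by apply: (fmorph_inj g); rewrite fK rmorph1.
exists h; split=> x; rewrite ?hE //.
by move=> Kx; rewrite -{1}(gK x Kx) gf.
Qed.

(** The indices enumerate the conjugates of [x], equivalently the cosets of its stabilizer; [s i] is
    a chosen representative of a coset. *)
Lemma finite_orbit (x : F) : exists d (s : 'I_d -> {rmorphism F -> F}),
  [/\ forall i, fixes K (s i), injective (fun i => s i x)
    & forall g : {rmorphism F -> F}, fixes K g -> exists i, g x = s i x].
Proof.
have [r [r_uniq xr gr]] := algebraic_roots x.
pose t := [seq y <- r | `[< exists g : {rmorphism F -> F}, fixes K g /\ y = g x >]].
have tP (i : 'I_(size t)) : exists g : {rmorphism F -> F}, fixes K g /\ t`_i = g x.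
  by have := mem_nth 0 (ltn_ord i); rewrite mem_filter => /andP[/asboolP].
have [s sP] := choice tP; exists (size t), s.
split=> [i|i j|g gK]; first by have [] := sP i.
  have [_ <-] := sP i; have [_ <-] := sP j => /eqP.
  by rewrite nth_uniq ?filter_uniq // => /eqP/val_inj.
have gt : g x \in t by rewrite mem_filter gr // andbT; apply/asboolP; exists g.
move: (gt); rewrite -index_mem => lt; exists (Ordinal lt).
by have [_ <-] := sP (Ordinal lt); rewrite nth_index.
Qed.

Lemma adjoin_subfield x : is_subfield (adjoin K x).
Proof.
split=> [|y z /set_mem Ky /set_mem Kz|y z /set_mem Ky /set_mem Kz]; apply/mem_set.
- by move=> M [subM _]; apply: subfield1.
- by move=> M MK; apply: subfieldB (Ky M MK) (Kz M MK); case: MK.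
- by move=> M MK; apply: subfield_div (Ky M MK) (Kz M MK); case: MK.
Qed.

Lemma sub_adjoin x : K `<=` adjoin K x.
Proof. by move=> y Ky M [_]; apply; left. Qed.

Lemma mem_adjoin x : adjoin K x x.
Proof. by move=> M [_]; apply; right. Qed.

Lemma adjoin_min x M : is_subfield M -> K `<=` M -> M x -> adjoin K x `<=` M.
Proof.
move=> subM KM Mx y Ky; apply: Ky; split=> // z [Kz|->]; [exact: KM|exact: Mx].
Qed.

Lemma fixes_adjoin (g : {rmorphism F -> F}) x :
  fixes (adjoin K x) g <-> fixes K g /\ g x = x.
Proof.
split=> [gx|[gK gx] y]; first by split=> [y Ky|]; apply: gx;
  [exact: sub_adjoin|exact: mem_adjoin].
apply: (@adjoin_min _ [set y | g y = y]) => //.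
split=> [|a b /set_mem/= ga /set_mem/= gb|a b /set_mem/= ga /set_mem/= gb];
  apply/mem_set => /=; first exact: rmorph1.
- by rewrite rmorphB ga gb.
- by rewrite fmorph_div ga gb.
Qed.

Lemma algebraic_over_sub (M : set F) : K `<=` M -> forall x : F, algebraic_over M x.
Proof.
move=> KM x; have [p [pK p0 px]] := algK x; exists p; split=> //.
by apply: polyOverS pK => y /set_mem/KM/mem_set.
Qed.

Lemma fixed_subfield (M : set F) x : is_subfield M -> K `<=` M ->
  (forall g : {rmorphism F -> F}, fixes M g -> g x = x) -> M x.
Proof.
by move=> subM KM; apply: fixed_by_automorphisms => //; apply: algebraic_over_sub.
Qed.

Lemma mem_adjoin_fixed x z :
  (forall g : {rmorphism F -> F}, fixes K g -> g x = x -> g z = z) -> adjoin K x z.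
Proof.
move=> fix_z; apply: fixed_subfield; [exact: adjoin_subfield|exact: sub_adjoin|].
by move=> g /fixes_adjoin[]; apply: fix_z.
Qed.

Lemma adjoin_agree (g h : {rmorphism F -> F}) x z :
  fixes K g -> fixes K h -> g x = h x -> adjoin K x z -> g z = h z.
Proof.
move=> gK hK gh Kz; have [h' [h'K hh' h'h]] := fixes_inv hK.
apply: (can_inj h'h); rewrite hh'.
have /(_ z Kz) //: fixes (adjoin K x) (h' \o g).
by apply/fixes_adjoin; split=> [y Ky|] /=; rewrite ?gh ?hh' // gK ?h'K.
Qed.

Lemma Vandermonde_unit (R : fieldType) d (x : 'rV[R]_d) :
  injective (x 0) -> Vandermonde d x \in unitmx.
Proof.
move=> x_inj; rewrite unitmxE unitfE det_Vandermonde.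
apply/prodf_neq0 => i _; apply/prodf_neq0 => j ij.
by rewrite subr_eq0; apply: contraTneq ij => /x_inj ->; rewrite ltnn.
Qed.

(* The coefficients of z over the powers of x interpolate the values (s i z) at
   the conjugates (s i x): by uniqueness of the interpolation they are fixed by
   all automorphisms. *)
Lemma orbit_ext_degree (x : F) d (s : 'I_d -> {rmorphism F -> F}) :
  (forall i, fixes K (s i)) -> injective (fun i => s i x) ->
  (forall g : {rmorphism F -> F}, fixes K g -> exists i, g x = s i x) ->
  ext_degree K (adjoin K x) d.
Proof.
move=> sK s_inj s_all; pose v := \row_i s i x.
have V := @Vandermonde_unit _ _ v.
have {}V : Vandermonde d v \in unitmx by apply: V => i j; rewrite !mxE => /s_inj.
have V_inj (c c' : 'rV_d) : c *m Vandermonde d v = c' *m Vandermonde d v -> c = c'.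
  by move=> e; rewrite -[c](mulmxK V) e mulmxK.
have VE (c : 'rV[F]_d) z i : (forall i, K (c 0 i)) -> z = \sum_(k < d) c 0 k * x ^+ k ->
    (c *m Vandermonde d v) 0 i = s i z.
  move=> cK ->; rewrite mxE rmorph_sum; apply: eq_bigr => k _.
  by rewrite !mxE rmorphM rmorphXn /= (sK i _ (cK k)).
exists (fun i => x ^+ i); split=> [i|z Kz].
  exact: (subfieldX (adjoin_subfield x) _ (@mem_adjoin x)).
pose w : 'rV[F]_d := \row_i s i z; pose c := w *m invmx (Vandermonde d v).
have cV : c *m Vandermonde d v = w by rewrite mulmxKV.
have cK i : K (c 0 i).
  apply: fixed_by_automorphisms => // g gK.
  suff : map_mx g c = c by move/rowP/(_ i); rewrite mxE.
  apply: V_inj; rewrite cV.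
  have perm i1 : exists i2, (g \o s i1) x = s i2 x by apply: s_all => y Ky /=;
    rewrite (sK i1 _ Ky) gK.
  have [f fE] := choice perm.
  have f_inj : injective f.
    move=> i1 i2 e; apply: s_inj; apply: (fmorph_inj g).
    by have := fE i1; have := fE i2; rewrite /= e => -> ->.
  apply/rowP => i2; rewrite -(f_invF f_inj i2); set i1 := invF f_inj i2.
  rewrite [RHS]mxE; have -> : s (f i1) z = g (s i1 z).
    apply/esym; apply: (adjoin_agree (g := g \o s i1) _ (sK _) (fE _) Kz).
    by move=> y Ky /=; rewrite (sK i1 _ Ky) gK.
  have -> : s i1 z = w 0 i1 by rewrite mxE.
  rewrite -cV !mxE rmorph_sum; apply: eq_bigr => k _.
  by rewrite !mxE rmorphM rmorphXn /= -fE.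
exists c; split=> [|c' [c'K zE]].
  have [i0 _] := s_all idfun (fun _ _ => erefl).
  by split=> //; apply: (fmorph_inj (s i0)); rewrite -(VE c _ i0 cK erefl) cV mxE.
apply: V_inj; rewrite cV; apply/rowP => i.
by rewrite mxE (VE c' z).
Qed.

(** The matrices [A] and [B] over K expressing each basis in the other satisfy [A *m B = 1] by
    uniqueness of coordinates, and the rank of the identity of size [d] is at most [d']. *)
Lemma ext_degree_le (L : set F) d d' :
  ext_degree K L d -> ext_degree K L d' -> (d <= d')%N.
Proof.
move=> [b [Lb bP]] [b' [Lb' b'P]].
have [A AP] : exists A : 'M[F]_(d, d'), (forall i j, K (A i j)) /\
    forall i, b i = \sum_j A i j * b' j.
  have /choice[f fP] : forall i, exists c : 'rV_d', (forall j, K (c 0 j)) /\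
    b i = \sum_j c 0 j * b' j by move=> i; have [c [cP _]] := b'P _ (Lb i); exists c.
  exists (\matrix_(i, j) f i 0 j); split=> [i j|i].
    by rewrite mxE; have [] := fP i.
  by have [_ {1}->] := fP i; apply: eq_bigr => j _; rewrite mxE.
have [B BP] : exists B : 'M[F]_(d', d), (forall i j, K (B i j)) /\
    forall i, b' i = \sum_j B i j * b j.
  have /choice[f fP] : forall i, exists c : 'rV_d, (forall j, K (c 0 j)) /\
    b' i = \sum_j c 0 j * b j by move=> i; have [c [cP _]] := bP _ (Lb' i); exists c.
  exists (\matrix_(i, j) f i 0 j); split=> [i j|i].
    by rewrite mxE; have [] := fP i.
  by have [_ {1}->] := fP i; apply: eq_bigr => j _; rewrite mxE.
have AB : A *m B = 1%:M.
  apply/row_matrixP => i; have [c [_ c_uniq]] := bP _ (Lb i).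
  rewrite -(c_uniq (row i 1%:M)) ?(c_uniq (row i (A *m B))) //.
    split=> [j|]; first by rewrite !mxE; apply: subfield_sum => // k _;
      apply: subfieldM => //; [case: AP|case: BP].
    have [_ {1}->] := AP; under eq_bigr =>
      k _ do (have [_ ->] := BP; rewrite mulr_sumr).
    rewrite exchange_big /=; apply: eq_bigr => k _; rewrite !mxE mulr_suml.
    by apply: eq_bigr => l _; rewrite mulrA.
  split=> [j|]; first by rewrite !mxE; apply: subfield_nat.
  rewrite (bigD1 i) //= !mxE eqxx mul1r big1 ?addr0 // => j ij.
  by rewrite !mxE eq_sym (negPf ij) mul0r.
have := mxrankM_maxl A B; rewrite AB mxrank1 => /leq_trans; apply.
exact: rank_leq_col.
Qed.

End Automorphisms.

(** * Invariance of coefficients under automorphisms, and primitive elements *)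

Section RationalFunctionsOverSubfields.
Variables (F : closedFieldType) (K : set F).
Hypothesis char0 : [pchar F] =i pred0.
Hypothesis subK : is_subfield K.
Hypothesis algK : forall x : F, algebraic_over K x.

Lemma natr_notin (s : seq F) : exists n : nat, n%:R \notin s.
Proof.
pose t := [seq n%:R : F | n <- iota 0 (size s).+1].
have t_uniq : uniq t.
  rewrite map_inj_in_uniq ?iota_uniq // => m n _ _ /eqP.
  wlog le : m n / (m <= n)%N => [th|].
    by case/orP: (leq_total m n) => [/th//|/th th' /eqP/esym/eqP/th' ->].
  move/pcharf0P: char0 => ch.
  by rewrite eq_sym -subr_eq0 -natrB // ch subn_eq0 => le'; apply/eqP;
    rewrite eqn_leq le.
have /allPn[_ /mapP[n _ ->] nP] : ~~ all (mem s) t.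
  apply/negP => /allP ts; have := uniq_leq_size t_uniq ts.
  by rewrite size_map size_iota ltnn.
by exists n.
Qed.

Lemma polyOver_fixed (p : {poly F}) :
  (forall g : {rmorphism F -> F}, fixes K g -> map_poly g p = p) ->
  p \is a polyOver (mem K).
Proof.
move=> pK; apply/(polyOver_subfield subK) => i.
by apply: fixed_by_automorphisms => // g gK; rewrite -coef_map pK.
Qed.

(** A reduced fraction with monic denominator is unique: by the Gauss lemma [q] and its conjugate
    divide each other. *)
Lemma reduced_fixed (g : {rmorphism F -> F}) (p q : {poly F}) :
  coprimep p q -> q \is monic -> map_poly g p * q = p * map_poly g q ->
  map_poly g p = p /\ map_poly g q = q.
Proof.
move=> cpq mq e; have mgq : map_poly g q \is monic by rewrite map_monic.
have q0 := monic_neq0 mq.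
have qg : map_poly g q = q.
  apply/esym/eqP; rewrite -eqp_monic // /eqp.
  have -> : q %| map_poly g q.
    by rewrite -(@Gauss_dvdpr _ (map_poly g q) p) 1?coprimep_sym // -e dvdp_mulIr.
  rewrite -(@Gauss_dvdpr _ q (map_poly g p)) ?coprimep_map 1?coprimep_sym //.
  by rewrite e dvdp_mulIr.
by split=> //; apply: (mulIf q0); rewrite e qg.
Qed.

Lemma frac_reduced (p q : {poly F}) : q != 0 -> exists a b : {poly F},
  [/\ p%:F / q%:F = a%:F / b%:F, coprimep a b & b \is monic].
Proof.
move=> q0; pose d := gcdp p q; have d0 : d != 0 by rewrite gcdp_eq0 (negPf q0) andbF.
have cpq1 : coprimep (p %/ d) (q %/ d) by rewrite coprimep_div_gcd // q0 orbT.
have /esym := divpK (dvdp_gcdl p q); have /esym := divpK (dvdp_gcdr p q).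
rewrite -/d; move: cpq1; set p1 := p %/ d; set q1 := q %/ d => cpq1 qE pE.
have q10 : q1 != 0 by apply: contraNneq q0 => q10; rewrite qE q10 mul0r.
have l0 : lead_coef q1 != 0 by rewrite lead_coef_eq0.
exists ((lead_coef q1)^-1 *: p1), ((lead_coef q1)^-1 *: q1); split.
- apply/eqP; rewrite eqr_div ?tofrac_eq0 ?scaler_eq0 ?invr_eq0 ?(negPf l0) //.
  rewrite -!tofracM tofrac_eq pE qE -!scalerAl -!scalerAr.
  by rewrite mulrAC mulrA mulrAC.
- by rewrite coprimepZl ?coprimepZr ?invr_eq0.
by rewrite monicE lead_coefZ mulVf.
Qed.

(** Having coefficients in K is invariance under the automorphisms over K. An invariant fraction
    need not have invariant terms, but its reduced form with monic denominator has. *)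
Lemma ratfun_overP (p q : {poly F}) : q != 0 ->
  ratfun_over K (p%:F / q%:F) <->
  forall g : {rmorphism F -> F}, fixes K g -> map_poly g p * q = p * map_poly g q.
Proof.
have cross (a b : {poly F}) : q != 0 -> b != 0 ->
    p%:F / q%:F = a%:F / b%:F <-> p * b = a * q.
  move=> q0 b0; split=> [/eqP|e]; last apply/eqP;
    rewrite eqr_div ?tofrac_eq0 // -!tofracM tofrac_eq ?e //.
  by move/eqP.
move=> q0; split=> [[a [b [aK bK b0]]] /(cross _ _ q0 b0) e g gK|fix_pq].
  have := congr1 (map_poly g) e; rewrite !rmorphM /= (fixes_map_poly subK gK aK)
    (fixes_map_poly subK gK bK) => eg.
  apply: (mulIf b0); transitivity (map_poly g p * b * q); first by ring.
  by rewrite eg -[RHS]mulrAC e; ring.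
have [a [b [e cab mb]]] := frac_reduced p q0.
have b0 := monic_neq0 mb; have /(cross _ _ q0 b0) pb := e.
have fix_ab (g : {rmorphism F -> F}) : fixes K g -> map_poly g a = a /\ map_poly g b =
  b.
  move=> gK; apply: reduced_fixed => //.
  have gpb := congr1 (map_poly g) pb; rewrite !rmorphM /= in gpb.
  have gq0 : map_poly g q != 0 by rewrite map_poly_eq0.
  apply: (mulIf (mulf_neq0 q0 gq0)).
  transitivity ((map_poly g a * map_poly g q) * (b * q)); first by ring.
  rewrite -gpb; transitivity ((map_poly g p * q) * (map_poly g b * b)); first by ring.
  rewrite (fix_pq g gK); transitivity ((p * b) * (map_poly g b * map_poly g q)); first
    by ring.
  by rewrite pb; ring.
exists a, b; split=> //; apply: polyOver_fixed => g /fix_ab[] //.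
Qed.

Lemma primitive_element (cs : seq F) : exists theta,
  (forall M, is_subfield M -> K `<=` M -> (forall c, c \in cs -> M c) -> M theta) /\
  (forall c, c \in cs -> adjoin K theta c).
Proof.
elim: cs => [|a cs [b [b_min bP]]].
  by exists 0; split=> // M subM _ _; apply: subfield0.
have [ra [_ ara raP]] := algebraic_roots subK algK a.
have [rb [_ brb rbP]] := algebraic_roots subK algK b.
(* The excluded values are those for which [a + y b = a' + y b'] with [b'] different from [b].
   Outside of them an automorphism fixing [a + y b] cannot move [b]. *)
have [y yP] := natr_notin [seq (a' - a) / (b - b') | a' <- ra, b' <- rb].
have theta_fix (g : {rmorphism F -> F}) :
    fixes K g -> g (a + y%:R * b) = a + y%:R * b -> g a = a /\ g b = b.
  move=> gK; rewrite rmorphD rmorphM rmorph_nat => e.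
  suff gb : g b = b by split=> //; move: e; rewrite gb => /addIr.
  apply: contraNeq yP => gb.
  apply/allpairsP; exists (g a, g b); rewrite raP // rbP //; split=> //=.
  apply: (canRL (mulfK _)); first by rewrite subr_eq0 eq_sym.
  have -> : g a = a + y%:R * b - y%:R * g b by rewrite -e addrK.
  by ring.
exists (a + y%:R * b); split=> [M subM KM Mcs|c].
  apply: subfieldD => //; first by apply: Mcs; rewrite mem_head.
  apply: subfieldM => //; first exact: subfield_nat.
  by apply: b_min => // c cs_c; apply: Mcs; rewrite in_cons cs_c orbT.
rewrite in_cons => /predU1P[->|/bP bc].
  by apply: mem_adjoin_fixed => // g gK /theta_fix[].
apply: (adjoin_min _ _ _ bc); [exact: adjoin_subfield|exact: sub_adjoin|].
by apply: mem_adjoin_fixed => // g gK /theta_fix[].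
Qed.

End RationalFunctionsOverSubfields.

(** * Generic points and rational maps of the line *)

Section GenericPoints.
Variable F : closedFieldType.
Hypothesis char0 : [pchar F] =i pred0.

Definition generically (P : F -> Prop) :=
  exists2 E : {poly F}, E != 0 & forall t, E.[t] != 0 -> P t.

Lemma generically_all (P : F -> Prop) : (forall t, P t) -> generically P.
Proof. by move=> allP; exists 1; [exact: oner_neq0|]. Qed.

Lemma generically_imp (P Q : F -> Prop) :
  (forall t, P t -> Q t) -> generically P -> generically Q.
Proof. by move=> PQ [E E0 EP]; exists E => // t /EP/PQ. Qed.

Lemma generically_and (P Q : F -> Prop) :
  generically P -> generically Q -> generically (fun t => P t /\ Q t).
Proof.
move=> [E E0 EP] [E' E'0 EQ]; exists (E * E'); first exact: mulf_neq0.
by move=> t; rewrite hornerM mulf_eq0 => /norP[/EP ? /EQ].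
Qed.

Lemma generically_forall (I : finType) (P : I -> F -> Prop) :
  (forall i, generically (P i)) -> generically (fun t => forall i, P i t).
Proof.
move=> aeP; have /choice[E EP] : forall i, exists E : {poly F},
    E != 0 /\ forall t, E.[t] != 0 -> P i t.
  by move=> i; have [E E0 EP] := aeP i; exists E.
exists (\prod_i E i); first by apply/prodf_neq0 => i _; have [] := EP i.
move=> t; rewrite horner_prod => /prodf_neq0 Et i.
by have [_] := EP i; apply; apply: Et.
Qed.

Lemma generically_neq0 (p : {poly F}) : p != 0 -> generically (fun t => p.[t] != 0).
Proof. by move=> p0; exists p. Qed.

Lemma generically_notin (s : seq F) : generically (fun t => t \notin s).
Proof.
exists (\prod_(z <- s) ('X - z%:P)); first exact/monic_neq0/monic_prod_XsubC.
by move=> t; apply: contra; rewrite -root_prod_XsubC.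
Qed.

(** An integer parameter is fixed by every automorphism; the choice of gamma depends on this. *)
Lemma generically_nat (P : F -> Prop) : generically P -> exists n : nat, P n%:R.
Proof.
move=> [E E0 EP]; have [r rE] := closed_field_poly_normal E.
have [n nr] := natr_notin char0 r; exists n; apply: EP.
rewrite rE hornerZ mulf_neq0 ?lead_coef_eq0 //.
by rewrite -[_ == 0]/(root _ _) root_prod_XsubC.
Qed.

Lemma generically_ex (P : F -> Prop) : generically P -> exists t, P t.
Proof. by move=> /generically_nat[n Pn]; exists n%:R. Qed.

Lemma generically_poly_eq (p q : {poly F}) :
  generically (fun t => p.[t] = q.[t]) -> p = q.
Proof.
move=> pq; apply/eqP; rewrite -subr_eq0; apply: contraT => /generically_neq0 pq0.
have [t [e]] := generically_ex (generically_and pq pq0).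
by rewrite hornerD hornerN e subrr eqxx.
Qed.

Lemma generically_rmorph (g : {rmorphism F -> F}) (h : F -> F) (P : F -> Prop) :
  cancel h g -> generically P -> generically (fun t => P (h t)).
Proof.
move=> hg [E E0 EP]; exists (map_poly g E); first by rewrite map_poly_eq0.
by move=> t; rewrite -{1}(hg t) horner_map fmorph_eq0 => /EP.
Qed.

Lemma generically_moebius (a b c d : F) (P : F -> Prop) :
  a * d - b * c != 0 -> generically P ->
  generically (fun t => P ((a * t + b) / (c * t + d))).
Proof.
move=> det [E E0 EP]; have [r rE] := closed_field_poly_normal E.
have cd0 : c *: 'X + d%:P != 0.
  apply: contraNneq det => cd; have := congr1 (coefp 0) cd; have := congr1 (coefp 1) cd.
  rewrite /= !coefE /= mulr1 mulr0 addr0 add0r => -> ->.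
  by rewrite !mulr0 subrr.
(* Where the denominator is nonzero, the factor attached to a root [z] of [E] vanishes exactly at
   the parameters mapped to [z]. *)
exists ((c *: 'X + d%:P) * \prod_(z <- r) ((a - z * c) *: 'X + (b - z * d)%:P)).
  apply: mulf_neq0 => //; rewrite prodf_seq_neq0; apply/allP => z _ /=.
  apply: contraNneq det => ab; have := congr1 (coefp 0) ab; have := congr1 (coefp 1) ab.
  rewrite /= !coefE /= mulr1 mulr0 addr0 add0r => /subr0_eq -> /subr0_eq ->.
  by apply/eqP; ring.
move=> t; rewrite hornerM horner_prod !hornerE mulf_eq0 => /norP[cdt rt].
apply: EP; rewrite rE hornerZ horner_prod mulf_neq0 ?lead_coef_eq0 //.
move: rt; rewrite !prodf_seq_neq0 => /allP rt; apply/allP => z /rt /=.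
apply: contra; rewrite hornerXsubC hornerD hornerZ hornerX hornerC subr_eq0 => /eqP e.
have -> : (a - z * c) * t + (b - z * d) = (a * t + b) - z * (c * t + d) by ring.
by rewrite -e divfK ?subrr.
Qed.

Lemma generically_affine (a b : F) (P : F -> Prop) :
  a != 0 -> generically P -> generically (fun t => P (a * t + b)).
Proof.
move=> a0 /(@generically_moebius a b 0 1)-/(_ _) => /(_ _)[].
  by rewrite mulr1 mulr0 subr0.
by move=> E E0 EP; exists E => // t /EP; rewrite mul0r add0r divr1.
Qed.

Lemma size_le1_deriv (p : {poly F}) : p %| p^`() -> (size p <= 1)%N.
Proof.
move=> pp'; rewrite leqNgt; apply/negP => p1.
have /(dvdp_leq (deriv_neq0 char0 p1)) := pp'.
by rewrite leqNgt lt_size_deriv // -size_poly_gt0 ltnW.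
Qed.

(** Here [m] is the degree of the function [N / D]. A generic [c] satisfies two conditions: the
    coefficient of degree [m] of [N - c D] is nonzero, and [c] is not the value of [N / D] at a zero
    of the numerator of its derivative, so that all roots are simple. *)
Lemma generic_fiber (N D : {poly F}) m :
  coprimep N D -> (0 < m)%N -> maxn (size N) (size D) = m.+1 ->
  generically (fun c => exists rs : seq F,
    [/\ uniq rs, size rs = m & forall t, (t \in rs) = root (N - c *: D) t]).
Proof.
move=> cND m0 szm.
(* W vanishes at the multiple roots of the N - c *: D. *)
pose W := N^`() * D - N * D^`().
have W0 : W != 0.
  rewrite subr_eq0; apply/eqP => e.
  suff [sN sD] : (size N <= 1)%N /\ (size D <= 1)%N.
    by have : (maxn (size N) (size D) <= 1)%N by [rewrite geq_max sN sD]; rewrite szm;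
      case: m m0 {szm}.
  split; apply: size_le1_deriv.
    by rewrite -(@Gauss_dvdpl _ _ D) // e dvdp_mulIl.
  by rewrite -(@Gauss_dvdpr _ _ N) 1?coprimep_sym // -e dvdp_mulIr.
have [zs zsE] := closed_field_poly_normal W.
have zsP t : (t \in zs) = root W t.
  by rewrite zsE rootZ ?lead_coef_eq0 // root_prod_XsubC.
have E0 : (N`_m)%:P - D`_m *: 'X != 0.
  apply/eqP => e; have := congr1 (coefp 0) e; have := congr1 (coefp 1) e.
  rewrite /= !coefE /= mulr0 subr0 sub0r mulr1 => /eqP; rewrite oppr_eq0 => /eqP Dm Nm.
  move: szm; rewrite /maxn; case: ltnP => _ sz.
    by have := lead_coef_eq0 D; rewrite lead_coefE sz /= Dm eqxx -size_poly_eq0 sz.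
  by have := lead_coef_eq0 N; rewrite lead_coefE sz /= Nm eqxx -size_poly_eq0 sz.
apply: generically_imp (generically_and (generically_neq0 E0)
  (generically_notin [seq N.[z] / D.[z] | z <- zs])) => c [].
rewrite !hornerE => cm cW; set p := N - c *: D.
have pm : p`_m != 0 by rewrite !coefE mulrC.
have sp : size p = m.+1.
  apply/eqP; rewrite eqn_leq; apply/andP; split.
    rewrite (leq_trans (size_polyD _ _)) // size_polyN geq_max -szm leq_maxl /=.
    by rewrite (leq_trans (size_scale_leq _ _)) // leq_maxr.
  by rewrite ltnNge; apply: contra pm => /(nth_default 0)->.
have [rs rsE] := closed_field_poly_normal p.
have p0 : p != 0 by rewrite -size_poly_eq0 sp.
have l0 : lead_coef p != 0 by rewrite lead_coef_eq0.
have rsP t : (t \in rs) = root p t by rewrite [in RHS]rsE rootZ // root_prod_XsubC.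
exists rs; split=> //.
  rewrite -separable_prod_XsubC; set R := \prod_(z <- rs) _.
  have -> : separable_poly R = separable_poly p.
    by apply: eqp_separable; rewrite rsE eqp_sym eqp_scale.
  rewrite unlock; apply: Pdiv.ClosedField.root_coprimep => t pt; apply: contra cW =>
    p't.
  have Nt : N.[t] = c * D.[t] by apply/eqP; move: pt; rewrite /root !hornerE subr_eq0.
  have N't : N^`().[t] = c * D^`().[t].
    by apply/eqP; move: p't; rewrite /p derivB derivZ !hornerE subr_eq0.
  have Dt : D.[t] != 0.
    apply: contraTneq cND => Dt; rewrite coprimep_sym.
    apply/negP => /coprimep_root/(_ (introT rootP Dt)).
    by rewrite Nt Dt mulr0 eqxx.
  apply/mapP; exists t; last by rewrite Nt mulfK.
  by rewrite zsP /root /W !hornerE Nt N't; apply/eqP; ring.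
have /eqP := sp; rewrite rsE size_scale // size_prod_XsubC eqSS => /eqP.
by [].
Qed.

End GenericPoints.

Section RationalMaps.
Variable F : closedFieldType.
Hypothesis char0 : [pchar F] =i pred0.

Lemma generically_two (P : F -> Prop) :
  generically P -> exists t t', [/\ t != t', P t & P t'].
Proof.
move=> aeP; have [t Pt] := generically_ex char0 aeP.
have [t' [Pt' t't]] :=
  generically_ex char0 (generically_and aeP (generically_notin [:: t])).
by exists t, t'; split=> //; rewrite eq_sym; rewrite inE in t't.
Qed.

(* A generic fiber has as many points as the degree, in characteristic 0. *)
Lemma injective_moebius (A B : {poly F}) (P : F -> Prop) :
  B != 0 -> generically P ->
  (forall t t', P t -> P t' -> A.[t] / B.[t] = A.[t'] / B.[t'] -> t = t') ->
  exists a b c d, a * d - b * c != 0 /\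
    generically (fun t => c * t + d != 0 /\ A.[t] * (c * t + d) = (a * t + b) * B.[t]).
Proof.
move=> B0 aeP inj.
pose G := gcdp A B; have G0 : G != 0 by rewrite gcdp_eq0 (negPf B0) andbF.
have cND : coprimep (A %/ G) (B %/ G) by rewrite coprimep_div_gcd // B0 orbT.
have := divpK (dvdp_gcdl A B); have := divpK (dvdp_gcdr A B); rewrite -/G.
move: cND; set N := A %/ G; set D := B %/ G => cND BE AE.
have D0 : D != 0 by apply: contraNneq B0 => D0; rewrite -BE D0 mul0r.
have nonconst k : N <> k *: D.
  move=> ND; have [t [t' [tt' [Pt Bt] [Pt' Bt']]]] :=
    generically_two (generically_and aeP (generically_neq0 B0)).
  suff e s : B.[s] != 0 -> A.[s] / B.[s] = k.
    by move/eqP: tt'; apply; apply: inj => //; rewrite !e.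
  by move=> Bs; rewrite -AE -BE ND -scalerAl BE hornerZ mulfK.
have [m szm] : exists m, maxn (size N) (size D) = m.+1.
  by exists (maxn (size N) (size D)).-1; rewrite prednK // leq_max !size_poly_gt0 D0
    orbT.
have m1 : m = 1%N.
  have [m0|m_gt1|//] := ltngtP m 1.
    move: szm; case: m m0 => // _ sz; have [sN sD] : (size N <= 1)%N /\ (size D <= 1)%N.
      by apply/andP; rewrite -geq_max sz.
    have DE := size1_polyC sD; have NE := size1_polyC sN.
    case: (nonconst (N`_0 / D`_0)); rewrite {1}NE {2}DE -mul_polyC -polyCM divfK //.
    by apply: contraNneq D0 => e; rewrite DE e.
  (* For [m] at least 2, a generic value [c] would be taken at two distinct parameters. Since [c]
     also avoids the values at the zeros of [E], both parameters are subject to the injectivity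
     assumption. *)
  have [E E0 EP] := generically_and aeP (generically_neq0 B0).
  have [zs zsE] := closed_field_poly_normal E.
  have Ezs t : t \notin zs -> E.[t] != 0.
    by rewrite zsE hornerZ mulf_eq0 lead_coef_eq0 (negPf E0) /= -root_prod_XsubC.
  have [c [[rs [rs_uniq rs_size rsP]] czs]] := generically_ex char0 (generically_and
    (generic_fiber char0 cND (ltnW m_gt1) szm)
    (generically_notin [seq N.[z] / D.[z] | z <- zs])).
  have rs_val t : t \in rs -> D.[t] != 0 /\ N.[t] / D.[t] = c.
    rewrite rsP /root hornerD hornerN hornerZ subr_eq0 => /eqP Nt.
    have Dt : D.[t] != 0.
      apply: contraTneq cND => Dt; rewrite coprimep_sym.
      apply/negP => /coprimep_root/(_ (introT rootP Dt)).
      by rewrite Nt Dt mulr0 eqxx.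
    by split=> //; rewrite Nt mulfK.
  have rs_good t : t \in rs -> P t /\ A.[t] / B.[t] = c.
    move=> trs; have [Dt Nt] := rs_val t trs.
    have [|Pt Bt] := EP t.
      apply: Ezs; apply: contra czs => tzs; apply/mapP; exists t => //.
    split=> //; rewrite -Nt -AE -BE !hornerM -mulf_div divff ?mulr1 //.
    by move: Bt; rewrite -BE hornerM mulf_eq0 => /norP[].
  move: rs_uniq rs_size rs_good; case: rs {rsP rs_val} => [|t [|t' rs]] /=; try
    by move=> _ e; rewrite -e in m_gt1.
  move=> /andP[]; rewrite inE negb_or => /andP[/eqP tt' _] _ _ good.
  have [Pt et] := good t (mem_head _ _); have [|Pt' et'] := good t'; first
    by rewrite !inE eqxx orbT.
  by case: tt'; apply: inj => //; rewrite et et'.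
have lin (p : {poly F}) : (size p <= 2)%N -> p = p`_1 *: 'X + (p`_0)%:P.
  move=> sp; apply/polyP => -[|[|i]]; rewrite !coefE /= ?mulr0 ?mulr1 ?add0r ?addr0 //.
  by rewrite nth_default // (leq_trans sp).
have [sN sD] : (size N <= 2)%N /\ (size D <= 2)%N.
  by apply/andP; rewrite -geq_max szm m1.
have NE := lin N sN; have DE := lin D sD.
exists N`_1, N`_0, D`_1, D`_0; split.
  apply/eqP => /eqP; rewrite subr_eq0 => /eqP det.
  have [c0|c0] := eqVneq D`_1 0; last first.
    apply: (nonconst (N`_1 / D`_1)); rewrite {1}NE {2}DE scalerDr scalerA.
    rewrite divfK //; congr (_ + _); rewrite -mul_polyC -polyCM; congr _%:P.
    by apply: (mulIf c0); rewrite mulrAC divfK // det.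
  have d0 : D`_0 != 0 by apply: contraNneq D0 => d0; rewrite DE c0 d0 scale0r addr0.
  have a0 : N`_1 = 0 by apply: (mulIf d0); rewrite det c0 mulr0 mul0r.
  apply: (nonconst (N`_0 / D`_0)); rewrite {1}NE {2}DE c0 a0 !scale0r !add0r.
  by rewrite -mul_polyC -polyCM divfK.
apply: generically_imp (generically_neq0 B0) => t Bt.
have Dt : D.[t] = D`_1 * t + D`_0 by rewrite {1}DE !hornerE.
have Nt : N.[t] = N`_1 * t + N`_0 by rewrite {1}NE !hornerE.
rewrite -Dt -Nt; split; last by rewrite -AE -BE !hornerM; ring.
by move: Bt; rewrite -BE hornerM mulf_eq0 => /norP[].
Qed.

(** One denominator with a free exponent is stable under sums and products, so it serves every
    polynomial expression in the components of a parametrization. Nothing is said at the zeros of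
    [D], where division yields default values. *)
Definition rational_with_denom (D : {poly F}) (h : F -> F) :=
  exists A e, forall t, D.[t] != 0 -> h t * D.[t] ^+ e = A.[t].

Section RationalWithDenom.
Variable D : {poly F}.

Lemma rational_poly (p : {poly F}) : rational_with_denom D (fun t => p.[t]).
Proof. by exists p, 0 => t _; rewrite expr0 mulr1. Qed.

Lemma rational_eq (h h' : F -> F) : h =1 h' ->
  rational_with_denom D h -> rational_with_denom D h'.
Proof. by move=> hh' [A [e AE]]; exists A, e => t /AE; rewrite hh'. Qed.

Lemma rational_add (h h' : F -> F) : rational_with_denom D h ->
  rational_with_denom D h' -> rational_with_denom D (fun t => h t + h' t).
Proof.
move=> [A [e AE]] [A' [e' A'E]]; exists (A * D ^+ e' + A' * D ^+ e), (e + e')%N.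
by move=> t Dt; rewrite exprD hornerD !hornerM !horner_exp -AE // -A'E //; ring.
Qed.

Lemma rational_mul (h h' : F -> F) : rational_with_denom D h ->
  rational_with_denom D h' -> rational_with_denom D (fun t => h t * h' t).
Proof.
move=> [A [e AE]] [A' [e' A'E]]; exists (A * A'), (e + e')%N.
by move=> t Dt; rewrite exprD hornerM -AE // -A'E //; ring.
Qed.

Lemma rational_meval n (f : {mpoly F[n]}) (x : F -> 'I_n -> F) :
  (forall i, rational_with_denom D (fun t => x t i)) ->
  rational_with_denom D (fun t => f.@[x t]).
Proof.
move=> xD.
have prodD (I : Type) (s : seq I) (h : I -> F -> F) :
    (forall i, rational_with_denom D (h i)) ->
      rational_with_denom D (fun t => \prod_(i <- s) h i t).
  move=> hD; elim: s => [|i s IHs].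
    by apply: (rational_eq _ (rational_poly 1)) => t; rewrite big_nil hornerC.
  by apply: (rational_eq _ (rational_mul (hD i) IHs)) => t; rewrite big_cons.
elim/mpolyind: f => [|c m p _ _ IHp].
  by apply: (rational_eq _ (rational_poly 0)) => t; rewrite meval0 horner0.
apply: (rational_eq _ (rational_add (rational_mul (rational_poly c%:P)
  (prodD _ (index_enum 'I_n) (fun i t => x t i ^+ m i) _)) IHp)) => [t|i].
  by rewrite mevalD mevalZ mevalX hornerC.
elim: (m i) => [|k IHk].
  by apply: (rational_eq _ (rational_poly 1)) => t; rewrite expr0 hornerC.
by apply: (rational_eq _ (rational_mul (xD i) IHk)) => t; rewrite exprS.
Qed.

Hypothesis D0 : D != 0.

Lemma rational_identity (h : F -> F) : rational_with_denom D h ->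
  generically (fun t => h t = 0) -> forall t, D.[t] != 0 -> h t = 0.
Proof.
move=> [A [e AE]] h0; have A0 : A = 0.
  apply: generically_poly_eq => //;
    apply: generically_imp (generically_and h0 (generically_neq0 D0)).
  by move=> t [ht Dt]; rewrite -AE // ht mul0r horner0.
move=> t Dt; apply: (mulIf (expf_neq0 e Dt)).
by rewrite AE // A0 horner0 mul0r.
Qed.

Lemma rational_dichotomy (h : F -> F) : rational_with_denom D h ->
  generically (fun t => h t = 0) \/ generically (fun t => h t != 0).
Proof.
move=> [A [e AE]]; have [A0|A0] := eqVneq A 0; [left|right].
  apply: generically_imp (generically_neq0 D0) => t Dt.
  by apply: (mulIf (expf_neq0 e Dt)); rewrite AE // A0 horner0 mul0r.
apply: generically_imp (generically_and (generically_neq0 D0) (generically_neq0 A0)).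
by move=> t [Dt]; rewrite -AE //; apply: contraNneq => ->; rewrite mul0r.
Qed.

End RationalWithDenom.
End RationalMaps.

(** * Conjugate parametrizations *)

Section Tuples.
Variables (F : closedFieldType) (N : nat).
Implicit Types (Phi : 'I_N -> {poly F} * {poly F}) (g : {rmorphism F -> F}).

Definition value Phi (t : F) : 'I_N -> F := fun j => (Phi j).1.[t] / (Phi j).2.[t].

Definition denominator Phi : {poly F} := \prod_j (Phi j).2.

Definition conj_tuple (g : F -> F) Phi : 'I_N -> {poly F} * {poly F} :=
  fun j => (map_poly g (Phi j).1, map_poly g (Phi j).2).

Lemma value_conj g Phi t j : value (conj_tuple g Phi) (g t) j = g (value Phi t j).
Proof. by rewrite /value /conj_tuple /= !horner_map fmorph_div. Qed.

Lemma denominator_neq0 Phi t : reflect (forall j, (Phi j).2.[t] != 0)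
  ((denominator Phi).[t] != 0).
Proof.
rewrite horner_prod; apply: (iffP (prodf_neq0 _ _)) => H j; last by move=> _; apply: H.
exact: H.
Qed.

Lemma rational_value Phi j : rational_with_denom (denominator Phi)
  (fun t => value Phi t j).
Proof.
exists ((Phi j).1 * \prod_(k | k != j) (Phi k).2), 1%N => t /denominator_neq0/(_ j) qt.
by rewrite /denominator (bigD1 j) //= expr1 /value !hornerM mulrA divfK.
Qed.

End Tuples.

Lemma meval_map_mpoly (R S : comNzRingType) (g : {rmorphism R -> S}) n
  (f : {mpoly R[n]}) (v : 'I_n -> R) :
  (map_mpoly g f).@[fun i => g (v i)] = g f.@[v].
Proof.
elim/mpolyind: f => [|c m p _ _ IHp]; first by rewrite rmorph0 !meval0 rmorph0.
rewrite rmorphD /= !mevalD rmorphD /= IHp; congr (_ + _).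
rewrite map_mpolyZ map_mpolyX !mevalZ !mevalX rmorphM rmorph_prod.
by congr (_ * _); apply: eq_bigr => i _; rewrite rmorphXn.
Qed.

Lemma fixes_map_mpoly (F : fieldType) (K : set F) (g : {rmorphism F -> F}) n
  (p : {mpoly F[n]}) :
  fixes K g -> p \is a mpolyOver n (mem K) -> map_mpoly g p = p.
Proof.
move=> gK /allP pK; apply/mpolyP => m; rewrite mcoeff_map_mpoly.
have [mp|/memN_msupp_eq0 ->] := boolP (m \in msupp p); last exact: rmorph0.
by apply/gK/set_mem/pK/map_f.
Qed.

Section ValueAt.
Variable F : fieldType.
Implicit Types (u v : {fraction {poly F}}) (t y z : F).

Lemma value_at_poly (p : {poly F}) t : value_at p%:F t p.[t].
Proof. by exists p, 1; rewrite tofrac1 hornerC oner_eq0 !divr1. Qed.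

Lemma value_atD u v t y z : value_at u t y -> value_at v t z ->
  value_at (u + v) t (y + z).
Proof.
move=> [p [q [-> qt ->]]] [p' [q' [-> qt' ->]]]; exists (p * q' + p' * q), (q * q').
have q0 (s : {poly F}) : s.[t] != 0 -> s%:F != 0.
  by move=> st; rewrite tofrac_eq0; apply: contraNneq st => ->; rewrite horner0.
split; first by rewrite addf_div ?q0 // tofracD !tofracM.
  by rewrite hornerM mulf_neq0.
by rewrite addf_div // !hornerE.
Qed.

Lemma value_atM u v t y z : value_at u t y -> value_at v t z ->
  value_at (u * v) t (y * z).
Proof.
move=> [p [q [-> qt ->]]] [p' [q' [-> qt' ->]]]; exists (p * p'), (q * q').
by split; [rewrite mulf_div !tofracM|rewrite hornerM mulf_neq0|rewrite mulf_div
  !hornerM].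
Qed.

Lemma value_at_uniq u t y z : value_at u t y -> value_at u t z -> y = z.
Proof.
move=> [p [q [-> qt ->]]] [p' [q' [/eqP + qt' ->]]].
have q0 (s : {poly F}) : s.[t] != 0 -> s%:F != 0.
  by move=> st; rewrite tofrac_eq0; apply: contraNneq st => ->; rewrite horner0.
rewrite eqr_div ?q0 // -!tofracM tofrac_eq => /eqP e.
by apply/eqP; rewrite eqr_div // -!hornerM e.
Qed.

(** No other fraction is defined at more points: if [q] vanished at [t], any fraction defined there
    would force [p] to vanish too, against coprimality. *)
Lemma value_at_reduced (p q : {poly F}) t y : coprimep p q -> q != 0 ->
  value_at (p%:F / q%:F) t y <-> q.[t] != 0 /\ y = p.[t] / q.[t].
Proof.
move=> cpq q0; split=> [|[qt ->]]; last by exists p, q.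
move=> [p' [q' [/eqP + qt' ->]]].
have q'0 : q' != 0 by apply: contraNneq qt' => ->; rewrite horner0.
rewrite eqr_div ?tofrac_eq0 // -!tofracM tofrac_eq => /eqP e.
have qt : q.[t] != 0.
  apply: contraTneq cpq => qt; rewrite coprimep_sym.
  apply/negP => /coprimep_root/(_ (introT rootP qt)).
  suff -> : p.[t] = 0 by rewrite eqxx.
  by apply: (mulIf qt'); rewrite -hornerM e hornerM qt mulr0 mul0r.
by split=> //; apply/eqP; rewrite eqr_div // -!hornerM e.
Qed.

End ValueAt.

Section Parametrization.
Variables (F : closedFieldType) (K : set F).
Hypothesis char0 : [pchar F] =i pred0.
Hypothesis subK : is_subfield K.
Hypothesis algK : forall x : F, algebraic_over K x.
Variables (N : nat) (C : set 'rV[F]_N) (phi : 'I_N -> {fraction {poly F}}).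
Variable Phi : 'I_N -> {poly F} * {poly F}.
Hypothesis phiE : forall j, phi j = (Phi j).1%:F / (Phi j).2%:F.
Hypothesis Phi_coprime : forall j, coprimep (Phi j).1 (Phi j).2.
Hypothesis Phi_neq0 : forall j, (Phi j).2 != 0.

Lemma denominator_Phi_neq0 : denominator Phi != 0.
Proof. by apply/prodf_neq0 => j _. Qed.

Lemma rational_meval_value (f : {mpoly F[N]}) :
  rational_with_denom (denominator Phi) (fun t => f.@[value Phi t]).
Proof. exact/rational_meval/rational_value. Qed.

Lemma vanishing_ideal_param (f : {mpoly F[N]}) : C =
  zariski_closure (param_image phi) ->
  vanishing_ideal C f <-> generically (fun t => f.@[value Phi t] = 0).
Proof.
move=> CE; split=> [fC|f0].
  apply: generically_imp (generically_neq0 denominator_Phi_neq0) =>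
    t /denominator_neq0 Dt.
  have -> : f.@[value Phi t] = f.@[(\row_j value Phi t j) 0].
    by apply: meval_eq => j; rewrite mxE.
  apply: fC; rewrite CE => h; apply; exists t => j.
  by rewrite phiE mxE; apply/value_at_reduced; rewrite ?Phi_neq0.
move=> x; rewrite CE => /(_ f); apply=> y [t yt].
have Dt : (denominator Phi).[t] != 0.
  by apply/denominator_neq0 => j; have := yt j; rewrite phiE =>
    /(value_at_reduced _ _ (Phi_coprime j) (Phi_neq0 j))[].
rewrite -(rational_identity char0 denominator_Phi_neq0 (rational_meval_value f) f0 Dt).
apply: meval_eq => j; have := yt j.
by rewrite phiE => /(value_at_reduced _ _ (Phi_coprime j) (Phi_neq0 j))[].
Qed.

(** An automorphism over K moves the cofactors of a combination but fixes the generators, whose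
    coefficients are in K. This is how the field of definition of C enters. *)
Lemma vanishing_ideal_conj (g : {rmorphism F -> F}) (f : {mpoly F[N]}) :
  defined_over K C -> fixes K g -> vanishing_ideal C f ->
    vanishing_ideal C (map_mpoly g f).
Proof.
move=> [G [GK GE]] gK; rewrite GE => -[s [sG ->]].
exists [seq (map_mpoly g w.1, w.2) | w <- s]; split.
  by move=> _ /mapP[w /sG Gw ->].
rewrite raddf_sum big_map big_seq [RHS]big_seq; apply: eq_bigr => w /sG/GK wK /=.
by rewrite rmorphM /= (fixes_map_mpoly gK wK).
Qed.

Lemma value_at_mmap (f : {mpoly F[N]}) t : (denominator Phi).[t] != 0 ->
  value_at (mmap (fun c : F => (c%:P)%:F) phi f) t f.@[value Phi t].
Proof.
move=> /denominator_neq0 Dt.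
pose cst : {rmorphism F -> {fraction {poly F}}} := @FracField.tofrac {poly F} \o polyC.
rewrite -[mmap _ _ _]/(mmap cst phi f).
elim/mpolyind: f => [|c m p _ _ IHp].
  by rewrite mmap0 meval0 -tofrac0 -[X in value_at _ _ X](horner0 t);
    apply: value_at_poly.
rewrite mmapD mevalD; apply: value_atD => //.
rewrite mmapZ mmapX /mmap1.
rewrite mevalZ mevalX; apply: value_atM.
  by rewrite -[X in value_at _ _ X](hornerC c t); apply: value_at_poly.
have v1 : value_at 1 t 1.
  by rewrite -tofrac1 -[X in value_at _ _ X](hornerC 1 t); apply: value_at_poly.
elim/big_rec2: _ => // i y u _ IH; apply: value_atM => //.
elim: (m i) => [|k IHk]; first by rewrite !expr0.
by rewrite !exprS; apply: value_atM => //; rewrite phiE; apply/value_at_reduced;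
  rewrite ?Phi_neq0.
Qed.

(** The inverse is kept in the product form [P = t Q], which holds at every parameter where all
    components are defined, including those where [Q] vanishes. *)
Lemma birational_pointwise : birational_parametrization phi C ->
  exists P Q : {mpoly F[N]}, generically (fun t => Q.@[value Phi t] != 0) /\
    forall t, (denominator Phi).[t] != 0 -> P.@[value Phi t] = t * Q.@[value Phi t].
Proof.
move=> [_ [P [Q /= [Q0 PQ]]]]; exists P, Q; split; last first.
  move=> t Dt; apply: value_at_uniq (value_at_mmap P Dt) _.
  rewrite -[X in value_at X](divfK Q0) PQ -{2}(hornerX t).
  by apply: value_atM (value_at_mmap Q Dt); apply: value_at_poly.
have [t0 Dt0] := generically_ex char0 (generically_neq0 denominator_Phi_neq0).
have [u [v [/esym uE v_t0 _]]] := value_at_mmap Q Dt0.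
have v0 : v != 0 by apply: contraNneq v_t0 => ->; rewrite horner0.
have u0 : u != 0 by apply: contraNneq Q0 => u0; rewrite -uE u0 tofrac0 mul0r.
apply: generically_imp (generically_and (generically_neq0 u0)
  (generically_and (generically_neq0 v0) (generically_neq0 denominator_Phi_neq0))).
move=> t [ut [vt Dt]]; have -> : Q.@[value Phi t] = u.[t] / v.[t].
  by apply: value_at_uniq (value_at_mmap Q Dt) _; rewrite -uE; exists u, v.
by rewrite mulf_neq0 ?invr_eq0.
Qed.

End Parametrization.

Section Homogenization.
Variables (F : fieldType) (N : nat).
Implicit Types (P Q : {mpoly F[N]}) (u : {poly F}).

(** This is [Q ^ m * u (P / Q)] cleared of denominators, for [u] of degree at most [m]. *)
Definition homogenize m P Q u : {mpoly F[N]} :=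
  \sum_(k < m.+1) u`_k *: (P ^+ k * Q ^+ (m - k)).

Lemma meval_homogenize m P Q u (y : 'I_N -> F) : (size u <= m.+1)%N -> Q.@[y] != 0 ->
  (homogenize m P Q u).@[y] = Q.@[y] ^+ m * u.[P.@[y] / Q.@[y]].
Proof.
move=> su Qy; rewrite /homogenize raddf_sum /=.
rewrite (horner_coef_wide _ su) mulr_sumr; apply: eq_bigr => k _.
rewrite mevalZ mevalM !rmorphXn /= expr_div_n [RHS]mulrCA; congr (_ * _).
have km : (k <= m)%N by rewrite -ltnS.
have -> : Q.@[y] ^+ m = Q.@[y] ^+ k * Q.@[y] ^+ (m - k) by rewrite -exprD subnKC.
by rewrite [Q.@[y] ^+ k * _]mulrC mulrACA mulfV ?expf_neq0 // mulr1 mulrC.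
Qed.

Lemma map_homogenize (g : {rmorphism F -> F}) m P Q u :
  map_mpoly g (homogenize m P Q u) = homogenize m (map_mpoly g P) (map_mpoly g Q)
    (map_poly g u).
Proof.
rewrite /homogenize rmorph_sum; apply: eq_bigr => k _.
by rewrite /= map_mpolyZ rmorphM /= !rmorphXn /= coef_map.
Qed.

End Homogenization.

(** * The Moebius transformation relating a parametrization to a conjugate *)

Section Moebius.
Variables (F : closedFieldType) (K : set F).
Hypothesis char0 : [pchar F] =i pred0.
Hypothesis subK : is_subfield K.
Hypothesis algK : forall x : F, algebraic_over K x.
Variables (N : nat) (Phi : 'I_N -> {poly F} * {poly F}).
Hypothesis Phi_coprime : forall j, coprimep (Phi j).1 (Phi j).2.
Hypothesis Phi_neq0 : forall j, (Phi j).2 != 0.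
Variables P Q : {mpoly F[N]}.
Hypothesis Q_neq0 : generically (fun t => Q.@[value Phi t] != 0).
Hypothesis PQ : forall t, (denominator Phi).[t] != 0 -> P.@[value Phi t] =
  t * Q.@[value Phi t].
Hypothesis ideal_conj : forall (g : {rmorphism F -> F}) (f : {mpoly F[N]}), fixes K g ->
  generically (fun t => f.@[value Phi t] = 0) ->
  generically (fun t => (map_mpoly g f).@[value Phi t] = 0).

Lemma generically_Phi_neq0 : generically (fun t => (denominator Phi).[t] != 0).
Proof. exact/generically_neq0/denominator_Phi_neq0. Qed.

(** If the conjugate of [Q] vanished on the curve, so would [Q], by the inverse automorphism. *)
Lemma conj_Q_neq0 (g : {rmorphism F -> F}) : fixes K g ->
  generically (fun t => (map_mpoly g Q).@[value Phi t] != 0).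
Proof.
move=> gK; have [h [hK gh hg]] := fixes_inv subK algK gK.
have [] // := rational_dichotomy (denominator_Phi_neq0 Phi_neq0)
  (rational_meval_value Phi (map_mpoly g Q)).
move/(ideal_conj hK) => Q0.
have [t []] := generically_ex char0 (generically_and Q0 Q_neq0).
suff -> : map_mpoly h (map_mpoly g Q) = Q by move=> -> /eqP.
by apply/mpolyP => m; rewrite !mcoeff_map_mpoly; apply: gh.
Qed.

(** The conjugate of the inverse map inverts the conjugate parametrization on the same curve.
    Applied to the point of parameter [t], it gives the value [v_g (t)]. *)
Lemma conj_inverse (g : {rmorphism F -> F}) : fixes K g ->
  generically (fun t => let v := (map_mpoly g P).@[value Phi t] /
    (map_mpoly g Q).@[value Phi t] in
    (denominator (conj_tuple g Phi)).[v] != 0 /\ value (conj_tuple g Phi) v =1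
      value Phi t).
Proof.
move=> gK.
suff /generically_forall : forall j, generically (fun t =>
    let v := (map_mpoly g P).@[value Phi t] / (map_mpoly g Q).@[value Phi t] in
    (conj_tuple g Phi j).2.[v] != 0 /\ value (conj_tuple g Phi) v j = value Phi t j).
  by apply: generically_imp => t Ht; split=> [|j];
    [apply/denominator_neq0 => j; case: (Ht j)|case: (Ht j)].
move=> j; set p := (Phi j).1; set q := (Phi j).2; set m := (size p + size q)%N.
have sp : (size p <= m.+1)%N by rewrite leqW ?leq_addr.
have sq : (size q <= m.+1)%N by rewrite leqW ?leq_addl.
(* The relation X_j = p (P / Q) / q (P / Q) holds on the curve; cleared of
   denominators it is in the ideal of the curve, and so is its conjugate. *)
have f0 : generically
  (fun t => ('X_j * homogenize m P Q q - homogenize m P Q p).@[value Phi t] = 0).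
  apply: generically_imp (generically_and Q_neq0 generically_Phi_neq0) => t [Qt Dt].
  rewrite mevalB mevalM mevalXU !meval_homogenize // PQ // mulfK // mulrCA -mulrBr.
  by rewrite /value divfK ?subrr ?mulr0 //; apply: (elimT (denominator_neq0 Phi t) Dt).
apply: generically_imp (generically_and (ideal_conj gK f0) (conj_Q_neq0 gK)) => t [].
rewrite rmorphB rmorphM /= map_mpolyX !map_homogenize => /eqP + Qt.
rewrite mevalB mevalM mevalXU !meval_homogenize ?size_map_poly // mulrCA -mulrBr.
rewrite mulf_eq0 expf_eq0 (negPf Qt) andbF /= subr_eq0 => /eqP.
set v := _ / _ => e /=; rewrite /value /conj_tuple /= -/p -/q.
have qv : (map_poly g q).[v] != 0.
  have : coprimep (map_poly g p) (map_poly g q) by rewrite coprimep_map;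
    exact: Phi_coprime.
  apply: contraTneq => qv; rewrite coprimep_sym.
  by apply/negP => /coprimep_root/(_ (introT rootP qv)); rewrite -e qv mulr0 eqxx.
by split=> //; rewrite -e mulfK.
Qed.

Lemma value_injective t t' : Q.@[value Phi t] != 0 -> (denominator Phi).[t] != 0 ->
  (denominator Phi).[t'] != 0 -> value Phi t =1 value Phi t' -> t = t'.
Proof.
move=> Qt Dt Dt' tt'; apply: (mulIf Qt); rewrite -PQ // (meval_eq _ tt') PQ //.
by rewrite (meval_eq _ tt').
Qed.

(** [v_g] is a rational function of [t]. It is injective on generic parameters, because [v_g (t)]
    determines the point of the curve and the point determines [t]; hence it has degree one. *)
Lemma conj_moebius (g : {rmorphism F -> F}) : fixes K g ->
  exists a b c d, a * d - b * c != 0 /\ generically (fun t =>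
    [/\ c * t + d != 0, (map_mpoly g Q).@[value Phi t] != 0,
        (map_mpoly g P).@[value Phi t] =
          (a * t + b) / (c * t + d) * (map_mpoly g Q).@[value Phi t]
      & value (conj_tuple g Phi) ((a * t + b) / (c * t + d)) =1 value Phi t]).
Proof.
move=> gK; have D0 := denominator_Phi_neq0 Phi_neq0; set D := denominator Phi.
have [A [e AE]] := rational_meval_value Phi (map_mpoly g P).
have [B [e' BE]] := rational_meval_value Phi (map_mpoly g Q).
have B0 : B != 0.
  apply/eqP => B0; have [t [Qt Dt]] :=
    generically_ex char0 (generically_and (conj_Q_neq0 gK) generically_Phi_neq0).
  by move/eqP: (BE t Dt); rewrite B0 horner0 mulf_eq0 (negPf Qt) expf_eq0 (negPf Dt)
    andbF.
have ABE t : D.[t] != 0 -> (A * D ^+ e').[t] / (B * D ^+ e).[t] =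
    (map_mpoly g P).@[value Phi t] / (map_mpoly g Q).@[value Phi t].
  move=> Dt; rewrite !hornerM !horner_exp -AE // -BE //.
  rewrite -[_ * _ * _ ^+ e']mulrA -[_ * _ * _ ^+ e]mulrA [_ ^+ e' * _]mulrC.
  by rewrite -mulf_div divff ?mulr1 // mulf_neq0 ?expf_neq0.
have good := generically_and (generically_and (conj_inverse gK) Q_neq0)
  generically_Phi_neq0.
have [||a [b [c [d [det Habcd]]]]] := injective_moebius char0 _ good (A := A * D ^+ e')
  (B := B * D ^+ e).
- by rewrite mulf_neq0 ?expf_neq0.
- move=> t t' [[[_ vt] Qt] Dt] [[[_ vt'] Qt'] Dt']; rewrite !ABE // => tt'.
  by apply: value_injective => // j; rewrite -vt -vt' tt'.
exists a, b, c, d; split=> //.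
apply: generically_imp (generically_and Habcd (generically_and good (conj_Q_neq0 gK))).
move=> t [[cdt ABt] [[[[_ vt] Qt] Dt] gQt]].
have vE : (map_mpoly g P).@[value Phi t] / (map_mpoly g Q).@[value Phi t] =
  (a * t + b) / (c * t + d).
  rewrite -ABE //; apply/eqP; rewrite eqr_div ?ABt //.
  by rewrite hornerM horner_exp -BE // !mulf_neq0 ?expf_neq0.
by split; rewrite // -vE // divfK.
Qed.

End Moebius.

(** * Descent by an affine substitution *)

Section AffineRelation.
Variables (F : closedFieldType) (N : nat).
Hypothesis char0 : [pchar F] =i pred0.
Implicit Types (u v w : F -> 'I_N -> F).

Definition affinely_related u v := exists a b, a != 0 /\
  generically (fun t => v (a * t + b) =1 u t).

Lemma affinely_related_eq u v : generically (fun t => v t =1 u t) ->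
  affinely_related u v.
Proof.
move=> uv; exists 1, 0; rewrite oner_eq0; split=> //.
by apply: generically_imp uv => t; rewrite mul1r addr0.
Qed.

Lemma affinely_related_sym u v : affinely_related u v -> affinely_related v u.
Proof.
move=> [a [b [a0 uv]]]; exists a^-1, (- (b / a)); rewrite invr_eq0; split=> //.
have a'0 : a^-1 != 0 by rewrite invr_eq0.
apply: generically_imp (generically_affine (- (b / a)) a'0 uv) => t e j.
by rewrite -e; congr (v _ j); field.
Qed.

Lemma affinely_related_trans u v w :
  affinely_related u v -> affinely_related v w -> affinely_related u w.
Proof.
move=> [a [b [a0 uv]]] [c [d [c0 vw]]]; exists (c * a), (c * b + d).
rewrite mulf_neq0 //; split=> //.
apply: generically_imp (generically_and uv (generically_affine b a0 vw)) => t [e e'] j.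
by rewrite -e -e'; congr (w _ j); ring.
Qed.

End AffineRelation.

Section Descent.
Variables (F : closedFieldType) (K : set F).
Hypothesis char0 : [pchar F] =i pred0.
Hypothesis subK : is_subfield K.
Hypothesis algK : forall x : F, algebraic_over K x.
Variables (N : nat).
Implicit Types (Phi : 'I_N -> {poly F} * {poly F}) (g h k : {rmorphism F -> F}).

Lemma value_conj_comp Phi g h t j :
  value (conj_tuple (g \o h) Phi) (g t) j = g (value (conj_tuple h Phi) t j).
Proof. by rewrite -value_conj /value /conj_tuple /= !map_poly_comp. Qed.

Lemma eq_conj_tuple Phi (g h : F -> F) : g =1 h -> conj_tuple g Phi = conj_tuple h Phi.
Proof. by move/funext => ->. Qed.

Lemma conj_tuple_comp Phi g h : conj_tuple (g \o h) Phi =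
  conj_tuple g (conj_tuple h Phi).
Proof. by apply/funext => j; rewrite /conj_tuple /= !map_poly_comp. Qed.

Lemma affinely_related_conj Phi g h k : fixes K g ->
  affinely_related (value (conj_tuple h Phi)) (value (conj_tuple k Phi)) ->
  affinely_related (value (conj_tuple (g \o h) Phi)) (value (conj_tuple (g \o k) Phi)).
Proof.
move=> gK [a [b [a0 hk]]]; have [g' [_ gg' g'g]] := fixes_inv subK algK gK.
exists (g a), (g b); rewrite fmorph_eq0; split=> //.
apply: generically_imp (generically_rmorph g'g hk) => t e j.
have -> : g a * t + g b = g (a * g' t + b) by rewrite rmorphD rmorphM /= g'g.
by rewrite value_conj_comp e -value_conj_comp g'g.
Qed.

Variable Phi : 'I_N -> {poly F} * {poly F}.
Variable good : F -> Prop.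
Hypothesis generically_good : generically good.
Hypothesis good_inj : forall t t', good t -> good t' -> value Phi t =1 value Phi t' ->
  t = t'.

(** In the notation of the overview: [v_g] is the affine map with slope [a] and constant term
    [b]. *)
Let valid g a b := a != 0 /\
  generically (fun t => value (conj_tuple g Phi) (a * t + b) =1 value Phi t).

Lemma valid_uniq g a b a' b' : fixes K g -> valid g a b -> valid g a' b' -> a =
  a' /\ b = b'.
Proof.
move=> gK [a0 v] [a'0 v']; have [h [_ gh hg]] := fixes_inv subK algK gK.
have good' := generically_rmorph hg generically_good.
suff e : a *: 'X + b%:P = a' *: 'X + b'%:P.
  have := congr1 (coefp 1) e; have := congr1 (coefp 0) e.
  by rewrite /= !coefE /= !mulr0 !mulr1 !add0r !addr0.
apply: (generically_poly_eq char0).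
apply: generically_imp (generically_and (generically_and v v')
  (generically_and (generically_affine b a0 good') (generically_affine b' a'0 good'))).
move=> t [[e e'] [gt gt']]; rewrite !hornerE.
apply: (can_inj hg); apply: good_inj => // j; apply: (fmorph_inj g).
by rewrite -!value_conj !hg e e'.
Qed.

(** The cocycle relation on affine maps, with the conjugate of [v_h] composed after [v_g]. *)
Lemma valid_comp g h a b c d : fixes K g -> valid g a b -> valid h c d ->
  valid (g \o h) (g c * a) (g c * b + g d).
Proof.
move=> gK [a0 v] [c0 v']; have [g' [_ gg' g'g]] := fixes_inv subK algK gK.
split; first by rewrite mulf_neq0 ?fmorph_eq0.
apply: generically_imp
  (generically_and v (generically_affine b a0 (generically_rmorph g'g v'))).
move=> t [e e'] j; rewrite -e -[in RHS](g'g (a * t + b)) value_conj -e'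
  -value_conj_comp.
by rewrite rmorphD rmorphM /= g'g; congr (value _ _ _); ring.
Qed.

Variables theta gamma : F.
Hypothesis Phi_theta : forall g, fixes K g -> g theta = theta ->
  generically (fun t => value (conj_tuple g Phi) t =1 value Phi t).
Hypothesis theta_gamma : forall g, fixes K g -> g theta = theta -> g gamma = gamma.
Hypothesis gamma_related : forall g, fixes K g -> g gamma = gamma ->
  affinely_related (value Phi) (value (conj_tuple g Phi)).

Lemma valid_theta g : fixes K g -> g theta = theta -> valid g 1 0.
Proof.
move=> gK /(Phi_theta gK) e; split; first exact: oner_neq0.
by apply: generically_imp e => t; rewrite mul1r addr0.
Qed.

Lemma valid_same g h a b : fixes K g -> fixes K h -> g theta = h theta ->
  valid h a b -> valid g a b.
Proof.
move=> gK hK gh v; have [h' [h'K hh' h'h]] := fixes_inv subK algK hK.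
have kK : fixes K (h' \o g) by move=> x Kx /=; rewrite gK // h'K.
have k_theta : (h' \o g) theta = theta by rewrite /= gh hh'.
have := valid_comp hK v (valid_theta kK k_theta).
rewrite rmorph1 rmorph0 !mul1r addr0 /valid.
by have /(eq_conj_tuple Phi) -> : h \o (h' \o g) =1 g by move=> x /=; rewrite h'h.
Qed.

(** The conclusion says [g f1 = a f1] and [g f2 = a f2 + b] whenever [g] fixes gamma and [v_g] has
    slope [a] and constant term [b]. It is applied twice: with theta equal to alpha, and with theta
    a primitive element of L. *)
Lemma affine_descent : exists f1 f2, [/\ adjoin K theta f1, adjoin K theta f2, f1 != 0
  & forall g, fixes K g -> g gamma = gamma -> generically (fun t =>
      value (conj_tuple g Phi) (g f1 * t + g f2) =1 value Phi (f1 * t + f2))].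
Proof.
have [d [s [sK s_inj s_all]]] := finite_orbit subK algK theta.
have /choice[ab abP] : forall g, exists ab : F * F,
    fixes K g -> g gamma = gamma -> valid g ab.1 ab.2.
  move=> g; have [[gK gg]|ng] := pselect (fixes K g /\ g gamma = gamma).
    by have [a [b abP]] := gamma_related gK gg; exists (a, b).
  (* A default outside of the stabilizer of gamma, where no affine map is claimed. *)
  by exists (0, 0) => gK gg; case: ng.
(* These indices are the conjugates of theta over K(gamma). The affine map attached to one of them
   depends only on the conjugate, by [valid_same]. *)
pose T := [pred i | s i gamma == gamma].
pose a i := (ab (s i)).1; pose b i := (ab (s i)).2.
have validT i : i \in T -> valid (s i) (a i) (b i) by move=> /eqP; apply: abP.
have a0 i : i \in T -> a i != 0 by move=> /validT[].
have gammaE g h : fixes K g -> fixes K h -> g theta = h theta -> g gamma = h gamma.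
  move=> gK hK gh; have [h' [h'K hh' h'h]] := fixes_inv subK algK hK.
  apply: (can_inj h'h); rewrite hh'; apply: (theta_gamma (g := h' \o g)).
    by move=> x Kx /=; rewrite gK // h'K.
  by rewrite /= gh hh'.
have [i0 i0E] := s_all idfun (fun _ _ => erefl).
have i0T : i0 \in T by rewrite inE -(gammaE idfun) // => x.
have perm g : fixes K g -> g gamma = gamma -> exists f : 'I_d -> 'I_d,
    [/\ injective f, forall i, (f i \in T) = (i \in T),
        forall i, g (s i theta) = s (f i) theta
      & forall i, i \in T -> a (f i) = g (a i) * (ab g).1 /\
                             b (f i) = g (a i) * (ab g).2 + g (b i)].
  move=> gK gg; have gsK i : fixes K (g \o s i) by move=> x Kx /=;
    rewrite (sK i _ Kx) gK.
  have /choice[f fE] : forall i, exists l, g (s i theta) = s l theta by move=> i;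
    apply: (s_all (g \o s i)) (gsK i).
  have fT i : (f i \in T) = (i \in T).
    by rewrite !inE -(gammaE (g \o s i) (s (f i))) //= -{2}gg (inj_eq (fmorph_inj g)).
  exists f; split=> // [i i' e|i iT].
    by apply: s_inj; apply: (fmorph_inj g); rewrite !fE e.
  have fiT : f i \in T by rewrite fT.
  apply: valid_uniq (validT _ fiT) _ => //.
  apply: (@valid_same _ (g \o s i)); [exact: sK|exact: gsK|by rewrite /= fE|].
  by apply: valid_comp => //; [apply: abP|apply: validT].
(* Averages over the conjugates of theta over gamma; the cocycle relation for
   (ab g) gives f1E and f2E below. *)
have [x [xK f10]] : exists x, adjoin K theta x /\ \sum_(i in T) s i x / a i != 0.
  have [/existsP[l k0]|] :=
    boolP [exists l : 'I_d, \sum_(i in T) s i (theta ^+ l) / a i != 0].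
    by exists (theta ^+ l); split=> //; apply: (subfieldX (adjoin_subfield K theta));
      apply: mem_adjoin.
  (* Otherwise the 1 / a i are in the kernel of a Vandermonde matrix. *)
  rewrite negb_exists => /forallP all0.
  pose v := \row_i s i theta; pose c : 'cV[F]_d :=
    \col_i (if i \in T then (a i)^-1 else 0).
  have V : Vandermonde d v \in unitmx by apply: Vandermonde_unit => i j;
    rewrite !mxE => /s_inj.
  have c0 : c = 0.
    rewrite -[c](mulKmx V); have -> : Vandermonde d v *m c = 0; last by rewrite mulmx0.
    apply/colP => k; rewrite mxE [RHS]mxE; have := all0 k; rewrite negbK => /eqP k0;
      rewrite -[RHS]k0.
    rewrite [RHS]big_mkcond; apply: eq_bigr => i _; rewrite !mxE rmorphXn.
    by case: ifP => // _; rewrite mulr0.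
  by have /colP/(_ i0)/eqP := c0; rewrite !mxE i0T invr_eq0 (negPf (a0 _ i0T)).
pose f1 := \sum_(i in T) s i x / a i.
(* The average of the zeros [- b i / a i] of the maps attached to [T]. By the cocycle relation [v_g]
   sends the zero with index [f i] to the image under [g] of the zero with index [i], and affine
   maps commute with averages; hence [v_g] sends [f2] to [g f2]. *)
pose f2 := - (\sum_(i in T) b i / a i) / #|T|%:R.
have T0 : #|T|%:R != 0 :> F.
  have /pcharf0P -> := char0; by rewrite -lt0n; apply/card_gt0P; exists i0.
have f1E g : fixes K g -> g gamma = gamma -> g f1 = (ab g).1 * f1.
  move=> gK gg; have [f [f_inj fT fE fab]] := perm g gK gg.
  have ag0 : (ab g).1 != 0 by case: (abP g gK gg).
  rewrite rmorph_sum mulr_sumr [RHS](reindex_inj f_inj) /=.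
  apply: eq_big => [i|i iT]; first by rewrite fT.
  have [-> _] := fab i iT; rewrite fmorph_div.
  have -> : g (s i x) = s (f i) x.
    apply: (adjoin_agree subK algK (g := g \o s i) _ (sK _) (fE i) xK).
    by move=> y Ky /=; rewrite (sK i _ Ky) gK.
  have gai0 : g (a i) != 0 by rewrite fmorph_eq0 a0.
  by field; rewrite ag0.
have f2E g : fixes K g -> g gamma = gamma -> g f2 = (ab g).1 * f2 + (ab g).2.
  move=> gK gg; have [f [f_inj fT fE fab]] := perm g gK gg.
  have ag0 : (ab g).1 != 0 by case: (abP g gK gg).
  rewrite /f2 fmorph_div rmorphN rmorph_nat rmorph_sum.
  have -> : \sum_(i in T) g (b i / a i) =
      (ab g).1 * (\sum_(i in T) b i / a i) - #|T|%:R * (ab g).2.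
    rewrite mulr_sumr [in RHS](reindex_inj f_inj) /= mulr_natl -sumr_const.
    rewrite [X in _ = X - _](eq_bigl (mem T)) => [|i]; last exact: fT.
    rewrite -sumrB; apply: eq_bigr => i iT.
    have [-> ->] := fab i iT; rewrite fmorph_div.
    have gai0 : g (a i) != 0 by rewrite fmorph_eq0 a0.
    by field; rewrite ag0.
  by move: T0; set m := #|T|%:R => m0; field.
exists f1, f2; split=> //.
- apply: mem_adjoin_fixed => // g gK gt; rewrite f1E ?theta_gamma //.
  have [-> _] := valid_uniq gK (abP g gK (theta_gamma gK gt)) (valid_theta gK gt).
  by rewrite mul1r.
- apply: mem_adjoin_fixed => // g gK gt; rewrite f2E ?theta_gamma //.
  have [-> ->] := valid_uniq gK (abP g gK (theta_gamma gK gt)) (valid_theta gK gt).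
  by rewrite mul1r addr0.
move=> g gK gg; have [_ v] := abP g gK gg.
apply: generically_imp (generically_affine f2 f10 v) => t e j.
by rewrite -e f1E // f2E //; congr (value _ _ _); rewrite /f1; ring.
Qed.

End Descent.

(** * Hyperplane sections of rational curves *)

Lemma digits_inj n B (m m' : 'I_n -> nat) : (forall i, m i < B)%N ->
  (forall i, m' i < B)%N ->
  (\sum_(i < n) m i * B ^ i = \sum_(i < n) m' i * B ^ i)%N -> m =1 m'.
Proof.
elim: n m m' => [|n IHn] m m' mB m'B; first by move=> _ [].
rewrite !big_ord_recl !expn0 !muln1.
have shift (k : 'I_n.+1 -> nat) : (\sum_(i < n) k (lift ord0 i) * B ^ lift ord0 i =
    (\sum_(i < n) k (lift ord0 i) * B ^ i) * B)%N.
  by rewrite big_distrl; apply: eq_bigr => i _; rewrite /= /bump add1n expnSr mulnA.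
rewrite !shift => e.
have B0 : (0 < B)%N by apply: leq_ltn_trans (mB ord0).
have e0 : m ord0 = m' ord0.
  by have := congr1 (modn^~ B) e; rewrite /= ![(_ ord0 + _)%N]addnC !modnMDl
    !modn_small.
have eS : (\sum_(i < n) m (lift ord0 i) * B ^ i = \sum_(i < n) m' (lift ord0 i) * B ^
  i)%N.
  by move: e; rewrite e0 => /addnI/eqP; rewrite eqn_pmul2r // => /eqP.
move=> i; case: (unliftP ord0 i) => [j ->|->] //.
exact: (IHn (fun j => m (lift ord0 j)) (fun j => m' (lift ord0 j))).
Qed.

(* Kronecker substitution. *)
Lemma mpoly_neq0_point (F : closedFieldType) n (f : {mpoly F[n]}) :
  [pchar F] =i pred0 -> f != 0 -> exists x : 'rV[F]_n, f.@[x 0] != 0.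
Proof.
move=> char0 f0; apply: contrapT => none.
have f_eq0 (x : 'I_n -> F) : f.@[x] = 0.
  apply: contrapT => /eqP fx; apply: none; exists (\row_i x i).
  by rewrite (meval_eq (v2 := x)) // => i; rewrite mxE.
pose B := msize f; pose e (m : 'X_{1..n}) := (\sum_(i < n) m i * B ^ i)%N.
pose G : {poly F} := \sum_(m <- msupp f) f@_m *: 'X^(e m).
have G0 : G = 0.
  apply: (generically_poly_eq char0); apply: generically_all => t.
  rewrite horner0 -(f_eq0 (fun i => t ^+ (B ^ i))) mevalE horner_sum.
  apply: eq_bigr => m _; rewrite hornerZ hornerXn; congr (_ * _).
  rewrite /e; elim/big_rec2: _ => [|i k y _ <-]; first by rewrite expr0.
  by rewrite exprD -exprM mulnC.
have e_inj m m' : m \in msupp f -> m' \in msupp f -> e m = e m' -> m = m'.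
  have small (m1 : 'X_{1..n}) : m1 \in msupp f -> forall i, (m1 i < B)%N.
    move=> /msize_mdeg_lt lt i; apply: leq_ltn_trans lt.
    by rewrite mdegE (bigD1 i) //= leq_addr.
  by move=> /small mB /small m'B /(digits_inj mB m'B) mm'; apply/mnmP.
have [m mf] : exists m, m \in msupp f.
  move: f0; rewrite -msupp_eq0; case: (msupp f) => // m l _; exists m.
  exact: mem_head.
have := congr1 (coefp (e m)) G0; rewrite /= coef0 coef_sum (bigD1_seq m) //=.
rewrite coefZ coefXn eqxx mulr1 big_seq_cond big1 ?addr0.
  by move/eqP; rewrite mcoeff_eq0 mf.
move=> m' /andP[m'f m'm]; rewrite coefZ coefXn; case: eqP => [/e_inj e'|];
  rewrite ?mulr0 //.
by rewrite e' // eqxx in m'm.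
Qed.

Lemma generically_meval_neq0 (F : closedFieldType) n (f : {mpoly F[n]})
  (x : F -> 'I_n -> F) :
  [pchar F] =i pred0 ->
  (forall i, exists p : {poly F}, forall t, x t i = p.[t]) ->
  (exists t, f.@[x t] != 0) -> generically (fun t => f.@[x t] != 0).
Proof.
move=> char0 xp [t0 ft0]; have [|A [e AE]] := @rational_meval F 1 n f x.
  by move=> i; have [p pE] := xp i; exists p, 0%N => t _; rewrite expr0 mulr1.
have AE' t : f.@[x t] = A.[t] by rewrite -AE hornerC ?oner_neq0 // expr1n mulr1.
exists A => [|t]; last by rewrite AE'.
by apply: contraNneq ft0 => A0; rewrite AE' A0 horner0.
Qed.

Lemma card_seq_II (T : eqType) (s : seq T) : uniq s -> ([set` s] #= `I_(size s))%card.
Proof.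
case: s => [|x0 s'] s_uniq.
  have -> : [set` [::]] = set0 :> set T by apply/seteqP; split=> x /=; rewrite ?in_nil.
  by rewrite II0.
move: (x0 :: s') s_uniq => s s_uniq.
have -> : [set` s] = nth x0 s @` `I_(size s).
  apply/seteqP; split=> [x /= xs|_ /= [k ks <-]]; last exact: mem_nth.
  by exists (index x s); rewrite /= ?index_mem ?nth_index.
apply: inj_card_eq => k l; rewrite !inE => ks ls /eqP.
by rewrite nth_uniq // => /eqP.
Qed.

Section HyperplaneSections.
Variables (F : closedFieldType) (n : nat).
Hypothesis char0 : [pchar F] =i pred0.
Variables (a b c d : 'I_n -> F).
Hypothesis det_neq0 : forall i, a i * d i - b i * c i != 0.

(* None is the pole at infinity. *)
Definition pole (i : 'I_n) : option F := if c i == 0 then None else Some (- d i / c i).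

Definition poles : seq (option F) := undup [seq pole i | i <- enum 'I_n].

Definition moebius_row (t : F) : 'rV[F]_n := \row_i ((a i * t + b i) / (c i * t + d i)).

Let ps : seq F := undup (pmap pole (enum 'I_n)).
(** Partial fractions: each Moebius function is a constant plus a nonzero multiple of [1 / (t - p)],
    or of [t] when its pole is at infinity. *)
Definition residue i := if c i == 0 then a i / d i else (b i * c i - a i * d i) / c i
  ^+ 2.
Definition regular_part i := if c i == 0 then b i / d i else a i / c i.
Definition principal_part (l : option F) t := if l is Some p then (t - p)^-1 else t.
(** The coefficient of the principal part at [l] in the combination of the Moebius functions with
    coefficients [kappa]. The pole survives in it exactly when this is nonzero. *)
Let weight (kappa : 'cV[F]_n) l := \sum_(i | pole i == l) kappa i 0 * residue i.

Lemma denom_neq0 t i : (c i * t + d i != 0) = (pole i != Some t).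
Proof.
rewrite /pole; have [c0|c0] := eqVneq (c i) 0.
  rewrite c0 mul0r add0r; apply: contraNneq (det_neq0 i) => d0.
  by rewrite c0 d0 !mulr0 subrr.
apply/idP/idP; apply: contra => /eqP.
  by case=> <-; apply/eqP; field.
move=> e; apply/eqP; congr Some; have -> : d i = - (c i * t) by apply/eqP;
  rewrite -addr_eq0 addrC e.
by field.
Qed.

Lemma mem_finite_poles p : (p \in ps) = [exists i, pole i == Some p].
Proof.
rewrite mem_undup mem_pmap; apply/mapP/existsP => [[i _ ->]|[i /eqP iE]]; exists i =>
  //.
by rewrite mem_enum.
Qed.

Lemma all_denom_neq0 t : (forall i, c i * t + d i != 0) <-> t \notin ps.
Proof.
rewrite mem_finite_poles negb_exists; split=> [dt|/forallP dt i]; last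
  by rewrite denom_neq0.
by apply/forallP => i; rewrite -denom_neq0.
Qed.

Lemma residue_neq0 i : residue i != 0.
Proof.
rewrite /residue; have [c0|c0] := eqVneq (c i) 0.
  have : a i * d i != 0 by have := det_neq0 i; rewrite c0 mulr0 subr0.
  by rewrite mulf_eq0 => /norP[a0 d0]; rewrite mulf_neq0 ?invr_neq0.
by rewrite mulf_neq0 ?invr_neq0 ?expf_neq0 // -opprB oppr_eq0.
Qed.

Lemma moebiusE i t : c i * t + d i != 0 ->
  (a i * t + b i) / (c i * t + d i) = regular_part i + residue i * principal_part
    (pole i) t.
Proof.
rewrite /regular_part /residue /pole /principal_part; have [c0|c0] := eqVneq (c i) 0.
  by rewrite c0 mul0r add0r => d0; field.
by move=> dt; field; rewrite c0 opprK mulrC.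
Qed.

Hypothesis pole_infinity : exists i, c i = 0.

Lemma size_poles : size poles = (size ps).+1.
Proof.
rewrite -(size_map Some ps) -[RHS]/(size (None :: map Some ps)).
apply/perm_size/uniq_perm; first exact: undup_uniq.
  rewrite /= map_inj_uniq ?undup_uniq ?andbT; last exact: Some_inj.
  by apply/mapP => -[].
move=> l; rewrite mem_undup in_cons; case: l => [p|] /=.
  rewrite mem_map; last exact: Some_inj.
  rewrite mem_finite_poles; apply/mapP/existsP => [[i _ ->]|[i /eqP iE]]; exists i =>
    //.
  by rewrite mem_enum.
apply/mapP; have [i ci] := pole_infinity; exists i; first by rewrite mem_enum.
by rewrite /pole ci eqxx.
Qed.

Let D : {poly F} := \prod_(p <- ps) ('X - p%:P).

(** The combination with coefficients [kappa], expanded by poles and multiplied by [D]. The pole at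
    infinity makes its degree exceed that of [D] by one. *)
Let numerator kappa : {poly F} :=
  D * (weight kappa None *: 'X + (\sum_i kappa i 0 * regular_part i)%:P)
  + \sum_(p <- ps) weight kappa (Some p) *: \prod_(q <- ps | q != p) ('X - q%:P).

Lemma root_pole_product t : (D.[t] == 0) = (t \in ps).
Proof. by rewrite -[_ == 0]/(root D t) root_prod_XsubC. Qed.

Lemma sum_by_pole (G : option F -> F) (H : 'I_n -> F) :
  \sum_i H i * G (pole i) = (\sum_(i | pole i == None) H i) * G None
    + \sum_(p <- ps) (\sum_(i | pole i == Some p) H i) * G (Some p).
Proof.
have -> : \sum_(p <- ps) (\sum_(i | pole i == Some p) H i) * G (Some p) =
    \sum_(i | pole i != None) H i * G (pole i).
  under eq_bigr => p _ do rewrite mulr_suml big_mkcond /=.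
  rewrite exchange_big /= [RHS]big_mkcond; apply: eq_bigr => i _.
  case E: (pole i) => [p|]; last by rewrite big1.
  have pps : p \in ps by rewrite mem_finite_poles; apply/existsP; exists i; rewrite E.
  rewrite (bigD1_seq p) ?undup_uniq //= eqxx big1 ?addr0 // => q qp.
  by rewrite (inj_eq (@Some_inj _)) eq_sym (negPf qp).
rewrite (bigID (fun i => pole i == None)) /= mulr_suml; congr (_ + _).
by apply: eq_bigr => i /eqP ->.
Qed.

Lemma numeratorE kappa t : t \notin ps ->
  (numerator kappa).[t] = D.[t] * \sum_i kappa i 0 * moebius_row t 0 i.
Proof.
move=> tps; have /all_denom_neq0 dt := tps.
have -> : \sum_i kappa i 0 * moebius_row t 0 i = \sum_i kappa i 0 * regular_part i
    + \sum_i kappa i 0 * residue i * principal_part (pole i) t.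
  rewrite -big_split; apply: eq_bigr => i _ /=.
  by rewrite mxE moebiusE // mulrDr mulrA.
rewrite (sum_by_pole (fun l => principal_part l t)) /= hornerD hornerM hornerD hornerZ
  hornerX hornerC.
rewrite addrA (addrC (\sum_i kappa i 0 * regular_part i)) [in RHS]mulrDr; congr (_ + _).
rewrite horner_sum mulr_sumr big_seq [RHS]big_seq; apply: eq_bigr => p pps.
rewrite hornerZ mulrCA; congr (_ * _); rewrite /D (bigD1_seq p) ?undup_uniq //=.
rewrite hornerM hornerXsubC mulrAC divff ?mul1r // subr_eq0.
by apply: contraNneq tps => ->.
Qed.

Lemma numerator_pole kappa p : p \in ps -> weight kappa (Some p) != 0 ->
  (numerator kappa).[p] != 0.
Proof.
move=> pps w0; rewrite hornerD hornerM; have /eqP -> : D.[p] == 0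
  by rewrite root_pole_product.
rewrite mul0r add0r horner_sum [X in X != 0](bigD1_seq p) ?undup_uniq //=
  [X in _ + X]big1_seq ?addr0.
  rewrite hornerZ mulf_neq0 // horner_prod prodf_seq_neq0; apply/allP => q _.
  by apply/implyP => qp; rewrite hornerXsubC subr_eq0 eq_sym.
move=> q /andP[qp _]; rewrite hornerZ horner_prod; apply/eqP.
rewrite mulf_eq0 prodf_seq_eq0; apply/orP; right; apply/hasP; exists p => //=.
by rewrite eq_sym qp hornerXsubC subrr eqxx.
Qed.

Lemma size_numerator kappa : weight kappa None != 0 ->
  size (numerator kappa) = (size ps).+2.
Proof.
move=> w0; have sD : size D = (size ps).+1 by rewrite size_prod_XsubC.
pose lin := weight kappa None *: 'X + (\sum_i kappa i 0 * regular_part i)%:P.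
have sl : size lin = 2.
  rewrite size_polyDl size_scale // size_polyX //.
  by rewrite (leq_ltn_trans (size_polyC_leq1 _)).
have D0 : D != 0 by rewrite -size_poly_eq0 sD.
have l0 : lin != 0 by rewrite -size_poly_eq0 sl.
have sDl : size (D * lin) = (size ps).+2 by rewrite size_mul // sD sl addn2.
rewrite /numerator -/lin size_polyDl ?sDl // ltnS.
apply: (leq_trans (size_sum _ _ _)); apply/bigmax_leqP_seq => p _ _.
apply: (leq_trans (size_scale_leq _ _)); rewrite -big_filter size_prod_XsubC ltnS.
by rewrite size_filter count_size.
Qed.

(** With the inverse residues as direction, the weight at a pole is affine in [y], with slope the
    number of indices having that pole, which is nonzero in characteristic 0. *)
Lemma weights_neq0 kappa0 : exists kappa1, generically (fun y =>
  forall i, weight (kappa0 + y *: kappa1) (pole i) != 0).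
Proof.
exists (\col_i (residue i)^-1); apply: generically_forall => i.
pose m := #|[pred k | pole k == pole i]|.
have E y : weight (kappa0 + y *: \col_i (residue i)^-1) (pole i) =
    (m%:R *: 'X + (weight kappa0 (pole i))%:P).[y].
  rewrite hornerD hornerZ hornerX hornerC /weight /m -sum1_card natr_sum mulr_suml
    -big_split.
  apply: eq_bigr => k _; rewrite !mxE mulrDl addrC mul1r; congr (_ + _).
  by rewrite -mulrA mulVf ?mulr1 // residue_neq0.
have m0 : m%:R != 0 :> F.
  have /pcharf0P -> := char0; rewrite -lt0n; apply/card_gt0P; exists i.
  by rewrite inE.
apply: (generically_imp (P := fun y => (m%:R *: 'X + (weight kappa0 (pole i))%:P).[y]
  != 0)) => [y|].
  by rewrite E.
apply: generically_neq0; apply: contraNneq m0 => e.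
have := congr1 (coefp 1) e.
by rewrite /= !coefE /= mulr1 addr0 => ->.
Qed.

(** On the curve, the hyperplane with normal vector [V *m kappa] becomes an equation between a
    combination of the Moebius functions and a constant. When no weight vanishes, that function has
    as many poles as there are distinct ones, all simple, and a generic fiber has that many
    points. *)
Lemma hyperplane_count (V : 'M[F]_n) (E : {mpoly F[n.+1]}) : V \in unitmx -> E != 0 ->
  exists h : 'rV[F]_n.+1, E.@[h 0] != 0 /\
  exists rs : seq F, [/\ uniq rs, size rs = size poles &
    forall t, t \in rs <-> (forall i, c i * t + d i != 0) /\
      \sum_(k < n) h 0 (lift ord0 k) * (moebius_row t *m invmx V) 0 k = h 0 ord0].
Proof.
move=> V_unit E0.
pose hyp z (kappa : 'cV[F]_n) : 'rV[F]_n.+1 :=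
  \row_l (if unlift ord0 l is Some k then (V *m kappa) k 0 else z).
have hyp_const z kappa : hyp z kappa 0 ord0 = z by rewrite mxE unlift_none.
have hyp_lift z kappa k : hyp z kappa 0 (lift ord0 k) = (V *m kappa) k 0.
  by rewrite mxE liftK.
(* Move from a hyperplane hs outside of E along a direction in which no
   residue vanishes identically, then vary the constant term. *)
have [hs hsE] := mpoly_neq0_point char0 E0.
pose kappa0 := invmx V *m \col_k hs 0 (lift ord0 k).
have hs_hyp : hyp (hs 0 ord0) kappa0 = hs.
  apply/rowP => l; rewrite mxE; case: (unliftP ord0 l) => [k ->|-> //].
  by rewrite mulKVmx // mxE.
have [kappa1 w0] := weights_neq0 kappa0.
have Ey : generically (fun y => E.@[hyp (hs 0 ord0) (kappa0 + y *: kappa1) 0] != 0).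
  apply: generically_meval_neq0 => // [l|]; last by exists 0;
    rewrite scale0r addr0 hs_hyp.
  case: (unliftP ord0 l) => [k ->|->].
    exists ((V *m kappa1) k 0 *: 'X + ((V *m kappa0) k 0)%:P) => y.
    rewrite hyp_lift mulmxDr -scalemxAr mxE [X in _ + X]mxE.
    by rewrite hornerD hornerZ hornerX hornerC addrC mulrC.
  by exists (hs 0 ord0)%:P => y; rewrite hyp_const hornerC.
have [y [wy {}Ey]] := generically_ex char0 (generically_and w0 Ey).
pose kappa := kappa0 + y *: kappa1.
have Ez : generically (fun z => E.@[hyp z kappa 0] != 0).
  apply: generically_meval_neq0 => // [l|]; last by exists (hs 0 ord0).
  case: (unliftP ord0 l) => [k ->|->].
    by exists ((V *m kappa) k 0)%:P => z; rewrite hyp_lift hornerC.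
  by exists 'X => z; rewrite hyp_const hornerX.
have wp p : p \in ps -> weight kappa (Some p) != 0.
  by rewrite mem_finite_poles => /existsP[i /eqP <-].
have wN : weight kappa None != 0.
  by have [i ci] := pole_infinity; have := wy i; rewrite /pole ci eqxx.
have cND : coprimep (numerator kappa) D.
  rewrite coprimep_sym; apply: Pdiv.ClosedField.root_coprimep => p.
  by rewrite /root root_pole_product => pps; apply: numerator_pole => //; apply: wp.
have szm : maxn (size (numerator kappa)) (size D) = (size ps).+2.
  by rewrite size_numerator // size_prod_XsubC; apply/maxn_idPl.
have [z [{}Ez [rs [rs_uniq rs_size rsP]]]] :=
  generically_ex char0 (generically_and Ez (generic_fiber char0 cND (ltn0Sn _) szm)).
exists (hyp z kappa); split=> //; exists rs; split=> // [|t]; first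
  by rewrite size_poles.
have -> : \sum_(k < n) hyp z kappa 0 (lift ord0 k) * (moebius_row t *m invmx V) 0 k =
    \sum_i kappa i 0 * moebius_row t 0 i.
  transitivity ((moebius_row t *m invmx V *m (V *m kappa)) 0 0).
    by rewrite [RHS]mxE; apply: eq_bigr => k _; rewrite hyp_lift mulrC.
  rewrite -mulmxA mulKmx // mxE; apply: eq_bigr => k _.
  by rewrite mulrC.
rewrite hyp_const rsP /root hornerD hornerN hornerZ subr_eq0.
have [tps|tps] := boolP (t \in ps).
  have /eqP -> : D.[t] == 0 by rewrite root_pole_product.
  rewrite mulr0 (negPf (numerator_pole tps (wp t tps))).
  by split=> // -[/all_denom_neq0]; rewrite tps.
rewrite numeratorE // mulrC (inj_eq (mulIf _)) ?root_pole_product //.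
by split=> [/eqP|[_ ->]] //; split=> //; apply/all_denom_neq0.
Qed.

End HyperplaneSections.

(** * The witness curve *)

Lemma meval_horner (R : comNzRingType) n (p : {poly R}) (L : {mpoly R[n]})
  (y : 'I_n -> R) :
  ((map_poly (@mpolyC n R) p).[L]).@[y] = p.[L.@[y]].
Proof.
rewrite -[LHS]horner_map -map_poly_comp (eq_map_poly (g := id)) ?map_poly_id //.
by move=> x; rewrite /= mevalC.
Qed.

Definition linear_form (R : comNzRingType) n (beta : R) : {mpoly R[n]} :=
  \sum_(i < n) beta ^+ i *: 'X_i.

Lemma meval_linear_form (R : comNzRingType) n (beta : R) (y : 'I_n -> R) :
  (linear_form n beta).@[y] = \sum_(i < n) beta ^+ i * y i.
Proof. by rewrite raddf_sum; apply: eq_bigr => i _; rewrite /= mevalZ mevalXU. Qed.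

(** The generic linear form is transcendental over F, so the substitution may be computed on the
    fraction [p / q]. Clearing denominators then leaves an identity of polynomials, valid at every
    point. *)
Lemma witness_identity (F : closedFieldType) n (alpha : F) (p q : {poly F})
    (num : 'I_n -> {mpoly F[n]}) (delta : {mpoly F[n]}) :
  [pchar F] =i pred0 -> (0 < n)%N -> q != 0 -> delta != 0 ->
  ratsubst (fun c => (c%:MP_[n])%:F) (\sum_(i < n) alpha ^+ i *: 'X_i)%:F (p%:F / q%:F)
    = \sum_(i < n) ((alpha ^+ i)%:MP_[n])%:F * ((num i)%:F / delta%:F) ->
  forall y : 'I_n -> F, let u := \sum_(i < n) alpha ^+ i * y i in
    p.[u] * delta.@[y] = (\sum_(i < n) alpha ^+ i * (num i).@[y]) * q.[u].
Proof.
move=> char0 n0 q0 d0; rewrite -/(linear_form n alpha) => e y u.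
pose h : {rmorphism F -> {fraction {mpoly F[n]}}} :=
  @FracField.tofrac {mpoly F[n]} \o @mpolyC n F.
have hE (r : {poly F}) : (map_poly h r).[(linear_form n alpha)%:F] =
    ((map_poly (@mpolyC n F) r).[linear_form n alpha])%:F.
  by rewrite map_poly_comp horner_map.
have tr (r : {poly F}) : r != 0 -> (map_poly h r).[(linear_form n alpha)%:F] != 0.
  move=> r0; rewrite hE tofrac_eq0; have [t rt] :=
    generically_ex char0 (generically_neq0 r0).
  apply: contraNneq rt => r_eq0.
  (* At the point [(t, 0, ..., 0)] the linear form takes the value [t], because [alpha ^+ 0 = 1]. *)
  have := meval_horner r (linear_form n alpha)
    (fun i => if (i == 0 :> nat)%N then t else 0).
  rewrite r_eq0 meval0 meval_linear_form; case: n n0 {e y u d0 num delta h hE r_eq0} =>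
    // m _.
  rewrite big_ord_recl /= expr0 mul1r big1 ?addr0 => [->//|i _].
  by rewrite mulr0.
move: e; rewrite (@ratsubstE _ _ h) // !hE.
have -> : \sum_(i < n) ((alpha ^+ i)%:MP_[n])%:F * ((num i)%:F / delta%:F) =
    (\sum_(i < n) alpha ^+ i *: num i)%:F / delta%:F.
  rewrite raddf_sum mulr_suml; apply: eq_bigr => i _ /=.
  by rewrite mulrA -tofracM mul_mpolyC.
move/eqP; rewrite eqr_div ?tofrac_eq0 //; last by rewrite -tofrac_eq0 -hE tr.
rewrite -!tofracM tofrac_eq => /eqP/(congr1 (meval y)).
rewrite !mevalM !meval_horner meval_linear_form raddf_sum => ->; congr (_ * _).
by apply: eq_bigr => i _; rewrite /= mevalZ.
Qed.

Section IrreducibleSets.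
Variables (F : closedFieldType) (n : nat).
Implicit Types (U : set 'rV[F]_n) (f g : {mpoly F[n]}).

Definition vanishes_on U f := forall x, U x -> f.@[x 0] = 0.

Lemma irreducible_prime U f g : irreducible_closed U ->
  vanishes_on U (f * g) -> vanishes_on U f \/ vanishes_on U g.
Proof.
move=> [_ _ irrU] fg0.
have cl (h : {mpoly F[n]}) : zariski_closed (zero_locus [set h]) by exists [set h].
have [|H|H] := irrU _ _ (cl f) (cl g).
- move=> x /fg0/eqP; rewrite mevalM mulf_eq0 => /orP[] /eqP e; [left|right];
    by move=> h ->.
- by left=> x /H; apply.
- by right=> x /H; apply.
Qed.

(** The values of [f] on [U] are among the roots of [e], and primality of the vanishing ideal
    selects one of them. *)
Lemma irreducible_constant U f (e : {poly F}) : irreducible_closed U -> e != 0 ->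
  (forall x, U x -> e.[f.@[x 0]] = 0) -> exists z, forall x, U x -> f.@[x 0] = z.
Proof.
move=> irrU e0 ef0; have [r rE] := closed_field_poly_normal e.
have {ef0} : vanishes_on U (\prod_(z <- r) (f - z%:MP)).
  move=> x /ef0; rewrite rE hornerZ horner_prod => /eqP.
  rewrite mulf_eq0 lead_coef_eq0 (negPf e0) /= rmorph_prod /= => /eqP <-.
  by apply: eq_bigr => z _; rewrite hornerXsubC mevalB mevalC.
elim: r {rE} => [|z r IHr].
  have [_ [x Ux] _] := irrU => /(_ x Ux)/eqP.
  by rewrite big_nil meval1 oner_eq0.
rewrite big_cons => /(irreducible_prime irrU)[fz|/IHr//].
by exists z => x /fz/eqP; rewrite mevalB mevalC subr_eq0 => /eqP.
Qed.

Lemma chain_two_points U : irreducible_chain U 1 -> exists x y, [/\ U x, U y & x != y].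
Proof.
move=> [X [Xirr Xlt]]; have [[_ [x Xx] _] _] := Xirr 0%N isT.
have [X01 X10] := Xlt 0%N isT; have [_ XU] := Xirr 1%N isT.
have [y [X1y X0y]] : exists y, X 1%N y /\ ~ X 0%N y.
  by apply: contrapT => none; apply: X10 => y X1y; apply: contrapT => X0y; apply: none;
    exists y.
exists x, y; split; [exact/XU/X01|exact: XU|].
by apply/eqP => xy; apply: X0y; rewrite -xy.
Qed.

End IrreducibleSets.

Section WitnessCurve.
Variables (F : closedFieldType) (K : set F).
Hypothesis char0 : [pchar F] =i pred0.
Hypothesis subK : is_subfield K.
Hypothesis algK : forall x : F, algebraic_over K x.
Variables (N : nat) (Phi : 'I_N -> {poly F} * {poly F}).
Hypothesis Phi_coprime : forall j, coprimep (Phi j).1 (Phi j).2.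
Variables P Q : {mpoly F[N]}.
Hypothesis Q_neq0 : generically (fun t => Q.@[value Phi t] != 0).
Hypothesis PQ : forall t, (denominator Phi).[t] != 0 -> P.@[value Phi t] =
  t * Q.@[value Phi t].
Variables (n : nat) (alpha : F) (s : 'I_n -> {rmorphism F -> F}).
Hypothesis sK : forall i, fixes K (s i).
Hypothesis s_inj : injective (fun i => s i alpha).
Variable i0 : 'I_n.
Hypothesis conj_i0 : conj_tuple (s i0) Phi = Phi.
Variables a b c d : 'I_n -> F.
Hypothesis det_neq0 : forall i, a i * d i - b i * c i != 0.
Hypothesis moebius : forall i, generically (fun t =>
    [/\ c i * t + d i != 0, (map_mpoly (s i) Q).@[value Phi t] != 0,
        (map_mpoly (s i) P).@[value Phi t] =
          (a i * t + b i) / (c i * t + d i) * (map_mpoly (s i) Q).@[value Phi t]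
      & value (conj_tuple (s i) Phi) ((a i * t + b i) / (c i * t + d i)) =1
        value Phi t]).
Variables (num : 'I_n -> 'I_N -> {mpoly F[n]}) (delta : {mpoly F[n]}).
Hypothesis num_K : forall i j, num i j \is a mpolyOver n (mem K).
Hypothesis delta_K : delta \is a mpolyOver n (mem K).
Hypothesis num_identity : forall j (y : 'I_n -> F), let u :=
  \sum_(i < n) alpha ^+ i * y i in
  (Phi j).1.[u] * delta.@[y] = (\sum_(i < n) alpha ^+ i * (num i j).@[y]) *
    (Phi j).2.[u].

Let lin i : {mpoly F[n]} := linear_form n (s i alpha).
Let W (x : 'rV[F]_n) :=
  (forall (i : 'I_n) j, (0 < i)%N -> (num i j).@[x 0] = 0) /\ delta.@[x 0] != 0.

(** The numerators and [delta] have coefficients in K, so an automorphism changes only alpha and the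
    parametrization. *)
Lemma conj_identity i j (y : 'I_n -> F) : let u := (lin i).@[y] in
  (map_poly (s i) (Phi j).1).[u] * delta.@[y] =
  (\sum_(k < n) s i alpha ^+ k * (num k j).@[y]) * (map_poly (s i) (Phi j).2).[u].
Proof.
have [h [hK sh hs]] := fixes_inv subK algK (sK i).
have shift (f : {mpoly F[n]}) : f \is a mpolyOver n (mem K) ->
    s i f.@[fun k => h (y k)] = f.@[y].
  move=> fK; rewrite -meval_map_mpoly (fixes_map_mpoly (sK i) fK).
  by apply: meval_eq => k; rewrite hs.
have := congr1 (s i) (num_identity j (fun k => h (y k))).
rewrite /= !rmorphM -!horner_map /= shift //.
have -> : s i (\sum_(k < n) alpha ^+ k * h (y k)) = (lin i).@[y].
  rewrite meval_linear_form rmorph_sum; apply: eq_bigr => k _.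
  by rewrite rmorphM rmorphXn /= hs.
move=> ->; congr (_ * _); rewrite rmorph_sum; apply: eq_bigr => k _.
by rewrite rmorphM rmorphXn /= shift.
Qed.

(** At a witness point only the term with exponent 0 of alpha survives in the numerator, and this
    term is the same for all conjugates. Coprimality excludes a vanishing denominator. *)
Lemma witness_value x : W x -> exists y : 'I_N -> F, forall i,
  (denominator (conj_tuple (s i) Phi)).[(lin i).@[x 0]] != 0 /\
  value (conj_tuple (s i) Phi) (lin i).@[x 0] =1 y.
Proof.
move=> [num0 dx]; pose k0 := Ordinal (leq_ltn_trans (leq0n i0) (ltn_ord i0)).
exists (fun j => (num k0 j).@[x 0] / delta.@[x 0]) => i; set u := (lin i).@[x 0].
have E j : (map_poly (s i) (Phi j).1).[u] * delta.@[x 0] =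
  (num k0 j).@[x 0] * (map_poly (s i) (Phi j).2).[u].
  rewrite conj_identity (bigD1 k0) //= expr0 mul1r big1 ?addr0 // => k kk0.
  by rewrite num0 ?mulr0 // lt0n.
have qu j : (map_poly (s i) (Phi j).2).[u] != 0.
  have : coprimep (map_poly (s i) (Phi j).1) (map_poly (s i) (Phi j).2)
    by rewrite coprimep_map.
  apply: contraTneq => qu; rewrite coprimep_sym.
  apply/negP => /coprimep_root/(_ (introT rootP qu)).
  suff -> : (map_poly (s i) (Phi j).1).[u] = 0 by rewrite eqxx.
  by apply: (mulIf dx); rewrite E qu mulr0 mul0r.
split=> [|j]; first exact/denominator_neq0.
by rewrite /value /conj_tuple /=; apply/eqP; rewrite eqr_div // E.
Qed.

Lemma conj_PQ i u : (denominator (conj_tuple (s i) Phi)).[u] != 0 ->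
  (map_mpoly (s i) P).@[value (conj_tuple (s i) Phi) u] =
  u * (map_mpoly (s i) Q).@[value (conj_tuple (s i) Phi) u].
Proof.
have [h [hK sh hs]] := fixes_inv subK algK (sK i) => Du.
have E (f : {mpoly F[N]}) : (map_mpoly (s i) f).@[value (conj_tuple (s i) Phi) u] =
    s i f.@[value Phi (h u)].
  by rewrite -meval_map_mpoly; apply: meval_eq => j; rewrite -value_conj hs.
rewrite !E PQ ?rmorphM /= ?hs //; apply/denominator_neq0 => j.
by have /denominator_neq0/(_ j) := Du; rewrite -{1}[u]hs /= horner_map fmorph_eq0.
Qed.

(* The second alternative describes finitely many exceptional points: fibers of
   the parametrizations over points where some (map_mpoly (s i) Q) vanishes. *)
Lemma witness_dichotomy : exists e : 'I_n -> {poly F}, (forall i, e i != 0) /\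
  forall x, W x ->
    (forall i, (lin i).@[x 0] * (c i * (lin i0).@[x 0] + d i) = a i * (lin i0).@[x 0] +
      b i)
    \/ forall i, (e i).[(lin i).@[x 0]] = 0.
Proof.
have [E E0 EP] := generically_forall moebius.
have [r rE] := closed_field_poly_normal E.
have Er t : E.[t] = 0 -> t \in r.
  move=> Et; have : root E t by apply/rootP.
  by rewrite rE rootZ ?lead_coef_eq0 // root_prod_XsubC.
have /choice[e' e'P] : forall i, exists e' : {poly F}, e' != 0 /\ forall u, e'.[u] != 0
  ->
    (map_mpoly (s i) Q).@[value (conj_tuple (s i) Phi) u] != 0.
  move=> i; have [h [hK sh hs]] := fixes_inv subK algK (sK i).
  have [e' e'0 e'P] := generically_rmorph hs Q_neq0; exists e'; split=> // u /e'P.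
  rewrite -(fmorph_eq0 (s i)) -meval_map_mpoly.
  by rewrite (meval_eq (v2 := value (conj_tuple (s i) Phi) u)) // => j;
    rewrite -value_conj hs.
pose v i z := (map_mpoly (s i) P).@[value Phi z] / (map_mpoly (s i) Q).@[value Phi z].
exists (fun i => e' i * \prod_(z <- r) ('X - (v i z)%:P)); split=> [i|x Wx].
  by rewrite mulf_neq0 ?(proj1 (e'P i)) // monic_neq0 // monic_prod_XsubC.
have [y yP] := witness_value Wx; set t := (lin i0).@[x 0].
have yE : y =1 value Phi t by move=> j; have [_ <-] := yP i0; rewrite conj_i0.
have PQi i : (map_mpoly (s i) P).@[value Phi t] =
  (lin i).@[x 0] * (map_mpoly (s i) Q).@[value Phi t].
  have [/conj_PQ + vE] := yP i.
  by rewrite !(meval_eq _ vE) !(meval_eq _ yE).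
have [Et|Et] := eqVneq E.[t] 0; [right|left] => i; last first.
  have [dt Qt Pt _] := EP t Et i; apply: (mulIf Qt).
  by rewrite mulrAC -PQi Pt mulrAC divfK.
rewrite hornerM horner_prod; have [->|/(proj2 (e'P i)) Qu] :=
  eqVneq (e' i).[(lin i).@[x 0]] 0.
  by rewrite mul0r.
have vE := proj2 (yP i); rewrite (meval_eq _ vE) (meval_eq _ yE) in Qu.
apply/eqP; rewrite mulf_eq0 prodf_seq_eq0; apply/orP; right; apply/hasP.
by exists t; [exact: Er|rewrite /= hornerXsubC subr_eq0 /v PQi mulfK].
Qed.

Let V := Vandermonde n (\row_i s i alpha).

Lemma orbit_Vandermonde_unit : V \in unitmx.
Proof. by apply: Vandermonde_unit => i j; rewrite !mxE => /s_inj. Qed.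

Lemma mulmx_orbit_Vandermonde (x : 'rV[F]_n) i : (x *m V) 0 i = (lin i).@[x 0].
Proof.
rewrite mxE meval_linear_form; apply: eq_bigr => k _.
by rewrite !mxE mulrC.
Qed.

Let point t : 'rV[F]_n := moebius_row a b c d t *m invmx V.

(** [U] is more than a point, so not all the conjugate coordinates are constant on it. By primality
    the exceptional alternative of [witness_dichotomy] would make them all constant, so [U]
    satisfies the equations of the Moebius curve. Conversely, a polynomial vanishing on [U] vanishes
    along the whole curve. *)
Lemma component_curve (Z U : set 'rV[F]_n) : Z = zariski_closure W ->
  irreducible_closed U -> U `<=` Z -> irreducible_chain U 1 ->
  forall x, U x <-> exists2 t, forall i, c i * t + d i != 0 & x = point t.
Proof.
move=> ZE irrU UZ U1.
have [x1 [x2 [Ux1 Ux2 x12]]] := chain_two_points U1.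
have UW f : vanishes_on W f -> vanishes_on U f.
  by move=> Wf x /UZ; rewrite ZE; apply.
have nonconst : ~ (forall k, exists z, forall x, U x -> (lin k).@[x 0] = z).
  move=> /choice[z zP]; move/eqP: x12; apply.
  have : x1 *m V = x2 *m V by apply/rowP => i; rewrite !mulmx_orbit_Vandermonde !(zP i).
  by move=> e; rewrite -(mulmxK orbit_Vandermonde_unit x1) e mulmxK //
    orbit_Vandermonde_unit.
have [e [e0 eP]] := witness_dichotomy.
pose curve i := lin i * (c i *: lin i0 + (d i)%:MP) - (a i *: lin i0 + (b i)%:MP).
have curveE i (x : 'rV[F]_n) : (curve i).@[x 0] =
  (lin i).@[x 0] * (c i * (lin i0).@[x 0] + d i) -
    (a i * (lin i0).@[x 0] + b i).
  by rewrite mevalB mevalM !mevalD !mevalZ !mevalC.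
have U_curve i : vanishes_on U (curve i).
  apply: contrapT => ncurve; apply: nonconst => k.
  apply: (irreducible_constant irrU (e0 k)) => x Ux.
  have : vanishes_on W (curve i * (map_poly (@mpolyC n F) (e k)).[lin k]).
    move=> z /eP[/(_ i)|/(_ k)] Hz; rewrite mevalM; last
      by rewrite meval_horner Hz mulr0.
    by rewrite curveE Hz subrr mul0r.
  move/UW/(irreducible_prime irrU) => [//|/(_ x Ux)].
  by rewrite meval_horner.
have on_curve x : U x -> let t := (lin i0).@[x 0] in
    (forall i, c i * t + d i != 0) /\ x = point t.
  move=> Ux t; have lt i : (lin i).@[x 0] * (c i * t + d i) = a i * t + b i.
    by apply/eqP; rewrite -subr_eq0 -curveE (U_curve i x Ux).
  have dt i : c i * t + d i != 0.
    apply: contraNneq (det_neq0 i) => dt.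
    have at0 : a i * t + b i = 0 by rewrite -lt dt mulr0.
    have [c0|c0] := eqVneq (c i) 0.
      have d0 : d i = 0 by move: dt; rewrite c0 mul0r add0r.
      by rewrite c0 d0 !mulr0 subrr.
    have tE : t = - d i / c i.
      by apply: (mulfI c0); rewrite [RHS]mulrC divfK //; apply/eqP;
        rewrite -addr_eq0 dt.
    have bE : b i = - (a i * t) by apply/eqP; rewrite -addr_eq0 addrC at0.
    by rewrite bE tE; apply/eqP; field.
  split=> //; rewrite -[x](mulmxK orbit_Vandermonde_unit); congr (_ *m _);
    apply/rowP => i.
  by rewrite mulmx_orbit_Vandermonde mxE -lt mulfK.
have D0 : \prod_i (c i *: 'X + (d i)%:P) != 0.
  apply/prodf_neq0 => i _; have [t [dt _]] : exists t, (forall k, c k * t + d k != 0)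
    /\ x1 = point t.
    by exists (lin i0).@[x1 0]; apply: on_curve.
  by apply: contraNneq (dt i) => e'; have := congr1 (horner^~ t) e';
    rewrite /= !hornerE => ->.
have DE t : (\prod_i (c i *: 'X + (d i)%:P)).[t] != 0 <->
  (forall i, c i * t + d i != 0).
  rewrite horner_prod; split=> [/prodf_neq0 dt i|dt].
    by have := dt i isT; rewrite hornerD hornerZ hornerX hornerC.
  by apply/prodf_neq0 => i _; rewrite hornerD hornerZ hornerX hornerC.
have rat k : rational_with_denom (\prod_i (c i *: 'X + (d i)%:P))
  (fun t => point t 0 k).
  pose Psi i := (a i *: 'X + (b i)%:P, c i *: 'X + (d i)%:P).
  apply: rational_eq (rational_meval (\sum_i invmx V i k *: 'X_i) (rational_value Psi))
    => t.
  rewrite raddf_sum mxE; apply: eq_bigr => i _.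
  by rewrite /= mevalZ mevalXU mxE /value /= !hornerD !hornerZ !hornerX !hornerC mulrC.
move=> x; split=> [/on_curve[dt xE]|[t dt ->]]; first by exists (lin i0).@[x 0].
have [[PU UE] _ _] := irrU; rewrite UE => f PUf.
have fU z : U z -> f.@[z 0] = 0 by rewrite UE => /(_ f PUf).
have [A [k AE]] := rational_meval f rat.
(* Otherwise the coordinate [lin i0], which is the parameter, would take finitely many values on
   [U]. It would then be constant, and with it all the other coordinates. *)
have A0 : A = 0.
  apply: contrapT => /eqP A0; apply: nonconst => i.
  have [t0 t0P] : exists z, forall x, U x -> (lin i0).@[x 0] = z.
    apply: (irreducible_constant irrU A0) => z Uz.
    have [dz zE] := on_curve z Uz; rewrite -AE; last exact/DE.
    by rewrite -zE fU // mul0r.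
  exists (moebius_row a b c d t0 0 i) => z Uz; have [dz zE] := on_curve z Uz.
  by rewrite -mulmx_orbit_Vandermonde {1}zE mulmxKV ?orbit_Vandermonde_unit // t0P.
have Dt : (\prod_i (c i *: 'X + (d i)%:P)).[t] != 0 by apply/DE.
by apply: (mulIf (expf_neq0 k Dt)); rewrite AE // A0 horner0 mul0r.
Qed.

End WitnessCurve.

(** * Equality of poles and affine relations between conjugates *)

Section Poles.
Variables (F : closedFieldType) (K : set F).
Hypothesis char0 : [pchar F] =i pred0.
Hypothesis subK : is_subfield K.
Hypothesis algK : forall x : F, algebraic_over K x.
Variables (N : nat) (Phi : 'I_N -> {poly F} * {poly F}).
Variable good : F -> Prop.
Hypothesis generically_good : generically good.
Hypothesis good_inj : forall t t', good t -> good t' -> value Phi t =1 value Phi t' ->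
  t = t'.
Variables (n : nat) (s : 'I_n -> {rmorphism F -> F}).
Hypothesis sK : forall i, fixes K (s i).
Variables a b c d : 'I_n -> F.
Hypothesis det_neq0 : forall i, a i * d i - b i * c i != 0.
Hypothesis moebius : forall i, generically (fun t => c i * t + d i != 0 /\
  value (conj_tuple (s i) Phi) ((a i * t + b i) / (c i * t + d i)) =1 value Phi t).

Lemma conj_good (g : {rmorphism F -> F}) : fixes K g -> exists2 good' : F -> Prop,
  generically good' & forall t t', good' t -> good' t' ->
    value (conj_tuple g Phi) t =1 value (conj_tuple g Phi) t' -> t = t'.
Proof.
move=> gK; have [h [_ gh hg]] := fixes_inv subK algK gK.
exists (fun t => good (h t)); first exact: generically_rmorph hg generically_good.
move=> t t' gt gt' e; apply: (can_inj hg); apply: good_inj => // j.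
by apply: (fmorph_inj g); rewrite -!value_conj !hg.
Qed.

Lemma numer_neq0 i t : c i * t + d i = 0 -> a i * t + b i != 0.
Proof.
move=> cd0; apply: contraNneq (det_neq0 i) => ab0.
have -> : d i = - (c i * t) by apply/eqP; rewrite -addr_eq0 addrC cd0.
have -> : b i = - (a i * t) by apply/eqP; rewrite -addr_eq0 addrC ab0.
by apply/eqP; ring.
Qed.

Lemma pole_some i p : (pole c d i == Some p) = (c i * p + d i == 0).
Proof. by have := denom_neq0 det_neq0 p i => /(congr1 negb); rewrite !negbK. Qed.

(** Generic injectivity forces the Moebius map to be the identity; cleared of its denominator, this
    is a polynomial identity whose coefficient of degree 2 is [c i]. *)
Lemma conj_i_pole_infinity i : conj_tuple (s i) Phi = Phi -> c i = 0.
Proof.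
move=> conj_i; have := generically_and (moebius i)
  (generically_and generically_good
    (generically_moebius (det_neq0 i) generically_good)).
rewrite conj_i => H.
have : a i *: 'X + (b i)%:P = 'X * (c i *: 'X + (d i)%:P) :> {poly F}.
  apply: (generically_poly_eq char0); apply: generically_imp H => t [[dt e] [gt gvt]].
  have vt : (a i * t + b i) / (c i * t + d i) = t by apply: good_inj.
  rewrite hornerM !hornerD !hornerZ !hornerX !hornerC -{2}vt divfK //.
by move/(congr1 (coefp 2)); rewrite /= coefXM !coefE /= mulr0 addr0 mulr1 addr0 => <-.
Qed.

(** The map from the parameter of the conjugate [i] to that of [j] is Moebius, and it is affine
    exactly when it fixes infinity, that is, when both parameters become infinite at the same
    [t]. *)
Lemma related_pole i j :
  affinely_related (value (conj_tuple (s i) Phi)) (value (conj_tuple (s j) Phi)) <->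
  pole c d i = pole c d j.
Proof.
split=> [[A [B [A0 AB]]]|ij].
  have [good' gen' inj'] := conj_good (sK j).
  have : (a j *: 'X + (b j)%:P) * (c i *: 'X + (d i)%:P) =
      (A *: (a i *: 'X + (b i)%:P) + B *: (c i *: 'X + (d i)%:P)) *
        (c j *: 'X + (d j)%:P).
    apply: (generically_poly_eq char0).
    apply: generically_imp (generically_and (generically_and (moebius i) (moebius j))
      (generically_and (generically_moebius (det_neq0 i) AB) (generically_and
        (generically_moebius (det_neq0 i) (generically_affine B A0 gen'))
        (generically_moebius (det_neq0 j) gen')))).
    move=> t [[[di vi] [dj vj]] [ABt [gi gj]]].
    have e : A * ((a i * t + b i) / (c i * t + d i)) + B =
      (a j * t + b j) / (c j * t + d j).
      by apply: inj' => // k; rewrite ABt vi vj.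
    rewrite !hornerM !hornerD !hornerZ !hornerD !hornerZ !hornerX !hornerC.
    have -> : a j * t + b j = (a j * t + b j) / (c j * t + d j) * (c j * t + d j)
      by rewrite divfK.
    by rewrite -e; field.
  move=> poly_eq.
  have eq_at p : (a j * p + b j) * (c i * p + d i) =
      (A * (a i * p + b i) + B * (c i * p + d i)) * (c j * p + d j).
    have := congr1 (horner^~ p) poly_eq.
    by rewrite /= !hornerM !hornerD !hornerZ !hornerD !hornerZ !hornerX !hornerC.
  have poleE p : (pole c d i == Some p) = (pole c d j == Some p).
    rewrite !pole_some; apply/eqP/eqP => e0; have := eq_at p;
      rewrite e0 ?mulr0 ?addr0 => /eqP.
      rewrite eq_sym !mulf_eq0 (negPf A0) (negPf (numer_neq0 e0)) /= => /eqP //.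
    by rewrite mulf_eq0 (negPf (numer_neq0 e0)) => /eqP.
  case Ei : (pole c d i) => [p|]; first by apply/esym/eqP; rewrite -poleE Ei.
  by case Ej : (pole c d j) => [p|] //; have := poleE p; rewrite Ei Ej eqxx.
have ri0 := residue_neq0 det_neq0 i; have rj0 := residue_neq0 det_neq0 j.
(* With equal poles, both functions have the same principal part, so the ratio of residues and the
   difference of constants give the affine relation. *)
pose A := residue a b c d j / residue a b c d i.
exists A, (regular_part a b c d j - A * regular_part a b c d i).
have A0 : A != 0 by rewrite mulf_neq0 ?invr_neq0.
split=> //.
have det' : d i * a i - (- b i) * (- c i) != 0 by rewrite mulrNN mulrC.
have ca0 : - c i *: 'X + (a i)%:P != 0.
  apply: contraNneq (det_neq0 i) => e; have := congr1 (coefp 0) e; have :=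
    congr1 (coefp 1) e.
  rewrite /= !coefE /= mulr1 mulr0 addr0 add0r => /eqP; rewrite oppr_eq0 => /eqP -> ->.
  by rewrite mulr0 mul0r subrr.
(* The relation is wanted at a generic parameter [u] of the conjugate [i]; [t] is its preimage under
   the Moebius map, by the inverse matrix. *)
apply: generically_imp (generically_and (generically_neq0 ca0)
  (generically_moebius det' (generically_and (moebius i) (moebius j)))).
move=> u [cau]; set t := _ / _ => -[[di vi] [dj vj]].
have cau' : - c i * u + a i != 0 by move: cau; rewrite !hornerE.
have uE : (a i * t + b i) / (c i * t + d i) = u.
  apply: (canLR (mulfK di)); rewrite /t; field.
  by move: cau'; rewrite mulNr.
move=> k; rewrite -[in RHS]uE vi -vj; congr (value _ _ k).
rewrite -uE (moebiusE a b di) (moebiusE a b dj) -ij /A.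
by field.
Qed.

End Poles.

(** All hyperplanes outside of the zeros of [D] meet [U] in [r] points, so one with a known count
    decides. Distinct parameters give distinct points, because the coordinate with pole at infinity
    is an affine function of [t]. *)
Lemma curve_degree_poles (F : closedFieldType) (n : nat) (a b c d : 'I_n -> F)
    (V : 'M[F]_n) (U : set 'rV[F]_n) r :
  [pchar F] =i pred0 -> (forall i, a i * d i - b i * c i != 0) ->
  (exists i, c i = 0) -> V \in unitmx ->
  (forall x, U x <-> exists2 t, forall i, c i * t + d i != 0 &
                                x = moebius_row a b c d t *m invmx V) ->
  curve_degree U r -> r = size (poles c d).
Proof.
move=> char0 det c0 V_unit UP [D [D0 DP]].
have [h [/DP card_r [rs [rs_uniq <- rsP]]]] := hyperplane_count char0 det c0 V_unit D0.
pose point t := moebius_row a b c d t *m invmx V.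
have point_inj : {in rs &, injective point}.
  move=> t t' /rsP[dt _] /rsP[dt' _] e; have [i ci] := c0.
  have /rowP/(_ i) : moebius_row a b c d t = moebius_row a b c d t'.
    by rewrite -[LHS](mulmxKV V_unit) -/(point t) e mulmxKV.
  have := dt i; rewrite !mxE ci !mul0r !add0r => di /(mulIf (invr_neq0 di)) /addIr.
  by apply: mulfI; have := det i; rewrite ci mulr0 subr0 mulf_eq0 => /norP[].
apply/card_eq_II; rewrite -(card_eql card_r).
have <- : [set` map point rs] =
  U `&` [set x | \sum_(i < n) h 0 (lift ord0 i) * x 0 i = h 0 ord0].
  apply/seteqP; split=> [_ /= /mapP[t /rsP[dt ht] ->]|x [/UP[t dt ->] ht]].
    by split=> //; apply/UP; exists t.
  by apply/mapP; exists t => //; apply/rsP.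
by rewrite -(size_map point rs); apply: card_seq_II; rewrite map_inj_in_uniq.
Qed.

(** * Fields of coefficients and the main theorem *)

Section AffineSubstitution.
Variables (F : closedFieldType) (N : nat).
Implicit Types (Phi : 'I_N -> {poly F} * {poly F}).

Definition affine_tuple Phi (e1 e2 : F) : 'I_N -> {poly F} * {poly F} :=
  fun j => ((Phi j).1 \Po (e1 *: 'X + e2%:P), (Phi j).2 \Po (e1 *: 'X + e2%:P)).

Lemma value_affine_tuple Phi e1 e2 t : value (affine_tuple Phi e1 e2) t =
  value Phi (e1 * t + e2).
Proof.
by apply/funext => j; rewrite /value /= !horner_comp hornerD hornerZ hornerX hornerC.
Qed.

Lemma conj_affine_tuple (g : {rmorphism F -> F}) Phi e1 e2 :
  conj_tuple g (affine_tuple Phi e1 e2) = affine_tuple (conj_tuple g Phi) (g e1) (g e2).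
Proof.
apply/funext => j; rewrite /conj_tuple /affine_tuple /=.
by rewrite !map_comp_poly rmorphD /= !linearZ /= map_polyX map_polyC.
Qed.

Lemma comp_affine_neq0 (p : {poly F}) e1 e2 : e1 != 0 -> p != 0 ->
  p \Po (e1 *: 'X + e2%:P) != 0.
Proof.
move=> e10 p0; rewrite -size_poly_eq0 size_comp_poly2 ?size_poly_eq0 //.
rewrite size_polyDl size_scale // size_polyX //.
by rewrite (leq_ltn_trans (size_polyC_leq1 _)).
Qed.

Lemma reparam_affine Phi (phi : 'I_N -> {fraction {poly F}}) e1 e2 j :
  (forall j, phi j = (Phi j).1%:F / (Phi j).2%:F) -> (forall j, (Phi j).2 != 0) ->
    e1 != 0 ->
  reparam phi (affine_sub e1 e2) j =
    (affine_tuple Phi e1 e2 j).1%:F / (affine_tuple Phi e1 e2 j).2%:F.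
Proof.
move=> phiE Phi0 e10; rewrite /reparam phiE /affine_sub.
pose h : {rmorphism F -> {fraction {poly F}}} := @FracField.tofrac {poly F} \o polyC.
have hE (r : {poly F}) : (map_poly h r).[(e1 *: 'X + e2%:P)%:F] =
  (r \Po (e1 *: 'X + e2%:P))%:F.
  by rewrite map_poly_comp horner_map.
rewrite (@ratsubstE _ _ h) ?hE // => r r0.
by rewrite hE tofrac_eq0 comp_affine_neq0.
Qed.

Lemma affinely_related_affine_tuple Phi e1 e2 : e1 != 0 ->
  affinely_related (value Phi) (value (affine_tuple Phi e1 e2)).
Proof.
move=> e10; exists e1^-1, (- e2 / e1); rewrite invr_eq0; split=> //.
apply: generically_all => t j; rewrite value_affine_tuple.
by congr (value _ _ _); field.
Qed.

End AffineSubstitution.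

Section FieldsOfCoefficients.
Variables (F : closedFieldType) (K : set F).
Hypothesis char0 : [pchar F] =i pred0.
Hypothesis subK : is_subfield K.
Hypothesis algK : forall x : F, algebraic_over K x.
Variables (N : nat) (Psi : 'I_N -> {poly F} * {poly F})
  (psi : 'I_N -> {fraction {poly F}}).
Hypothesis psiE : forall j, psi j = (Psi j).1%:F / (Psi j).2%:F.
Hypothesis Psi_neq0 : forall j, (Psi j).2 != 0.

Lemma ratfun_over_value (M : set F) : is_subfield M -> K `<=` M ->
  (forall j, ratfun_over M (psi j)) <->
  (forall g : {rmorphism F -> F}, fixes M g ->
     generically (fun t => value (conj_tuple g Psi) t =1 value Psi t)).
Proof.
move=> subM KM; have algM := algebraic_over_sub algK KM.
have nz : generically (fun t => forall j, (Psi j).2.[t] != 0).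
  by apply: generically_forall => j; apply: generically_neq0.
have conj_nz (g : {rmorphism F -> F}) :
  generically (fun t => forall j, (map_poly g (Psi j).2).[t] != 0).
  by apply: generically_forall => j; apply: generically_neq0; rewrite map_poly_eq0.
split=> [psiM g gM|inv j].
  apply: generically_imp (generically_and nz (conj_nz g)) => t [qt gqt] j.
  have := psiM j; rewrite psiE =>
    /(ratfun_overP char0 subM algM _ (Psi_neq0 j))/(_ g gM) e.
  by rewrite /value /=; apply/eqP; rewrite eqr_div // -!hornerM e.
rewrite psiE; apply/(ratfun_overP char0 subM algM _ (Psi_neq0 j)) => g gM.
apply: (generically_poly_eq char0).
apply: generically_imp (generically_and (inv g gM) (generically_and nz (conj_nz g))) =>
  t [e [qt gqt]].
by have /eqP := e j; rewrite /value /= eqr_div // -!hornerM => /eqP.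
Qed.

(** The field is generated by the coefficients of the reduced forms with monic denominators: these
    are fixed by all automorphisms over any field containing K over which the parametrization is
    defined, hence belong to it. *)
Lemma coef_field_primitive : exists2 theta, coef_field K psi = adjoin K theta &
  forall j, ratfun_over (adjoin K theta) (psi j).
Proof.
have /choice[R RP] : forall j, exists R : {poly F} * {poly F},
    [/\ psi j = R.1%:F / R.2%:F, coprimep R.1 R.2 & R.2 \is monic].
  by move=> j; have [p [q pq]] := frac_reduced (Psi j).1 (Psi_neq0 j); exists (p, q);
    rewrite psiE.
pose cs := flatten [seq (R j).1 ++ (R j).2 | j <- enum 'I_N].
have [theta [theta_min theta_cs]] := primitive_element char0 subK algK cs.
have subT := adjoin_subfield K theta.
have coefs (M : set F) (p : {poly F}) : is_subfield M -> {subset (p : seq F) <= cs} ->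
    (forall x, x \in cs -> M x) -> p \is a polyOver (mem M).
  by move=> subM pcs csM; apply/allP => x /pcs/csM/mem_set.
have csR j : {subset ((R j).1 : seq F) <= cs} /\ {subset ((R j).2 : seq F) <= cs}.
  by split=> x xp; apply/flattenP; exists ((R j).1 ++ (R j).2);
    rewrite ?mem_cat ?xp ?orbT //; apply/mapP; exists j; rewrite ?mem_enum.
have psiT j : ratfun_over (adjoin K theta) (psi j).
  have [csp csq] := csR j; have [psijE _ monq] := RP j.
  exists (R j).1, (R j).2; split=> //; [exact: coefs|exact: coefs|].
  exact: monic_neq0.
exists theta => //; apply/seteqP; split=> x.
  by apply; split; [split|exact: sub_adjoin].
move=> Tx M [[subM psiM] KM]; apply: (adjoin_min subM KM _ Tx); apply: theta_min =>
  // y.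
have algM := algebraic_over_sub algK KM.
have RM (g : {rmorphism F -> F}) : fixes M g -> forall j,
    map_poly g (R j).1 = (R j).1 /\ map_poly g (R j).2 = (R j).2.
  move=> gM j; have [psijE cR mR] := RP j; apply: reduced_fixed => //.
  have := psiM j; rewrite psijE => /(ratfun_overP char0 subM algM _ (monic_neq0 mR)).
  exact.
move=> /flattenP[_ /mapP[j _ ->]]; rewrite mem_cat => yR.
apply: (fixed_by_automorphisms char0 subM algM) => g gM; have [R1 R2] := RM g gM j.
by case/orP: yR => /(nthP 0)[k _ <-]; rewrite -coef_map /= ?R1 ?R2.
Qed.

End FieldsOfCoefficients.

Section BlockElement.
Variables (F : closedFieldType) (K : set F).
Hypothesis char0 : [pchar F] =i pred0.
Hypothesis subK : is_subfield K.
Hypothesis algK : forall x : F, algebraic_over K x.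
Variables (n : nat) (alpha : F) (s : 'I_n -> {rmorphism F -> F}).
Hypothesis sK : forall i, fixes K (s i).
Hypothesis s_inj : injective (fun i => s i alpha).
Hypothesis s_all : forall g : {rmorphism F -> F}, fixes K g -> exists i, g alpha =
  s i alpha.
Variables (T : eqType) (label : 'I_n -> T).
Hypothesis label_compat : forall (g : {rmorphism F -> F}) i k i' k', fixes K g ->
  g (s i alpha) = s i' alpha -> g (s k alpha) = s k' alpha -> label i = label k ->
    label i' = label k'.

Let block i : {poly F} := \prod_(k | label k == label i) ('X - (s k alpha)%:P).

Lemma root_block i k : root (block i) (s k alpha) = (label k == label i).
Proof.
rewrite /root horner_prod; apply/idP/idP => [/prodf_eq0[l /eqP <-]|ki].
  by rewrite hornerXsubC subr_eq0 => /eqP/s_inj ->.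
by apply/prodf_eq0; exists k; rewrite // hornerXsubC subrr.
Qed.

Lemma eq_block i k : block i = block k <-> label i = label k.
Proof.
split=> [e|e]; last by rewrite /block e.
by apply/eqP; rewrite -root_block -e root_block.
Qed.

(** Distinct blocks of conjugates have distinct polynomials, whose values at a generic [c] differ.
    With [c] an integer, an automorphism permutes these values as it permutes the blocks. *)
Lemma block_element : exists gamma (gammas : 'I_n -> F),
  (forall (g : {rmorphism F -> F}) i, fixes K g -> g alpha = s i alpha -> g gamma =
    gammas i) /\
  (forall i k, gammas i = gammas k <-> label i = label k).
Proof.
have [i0 i0E] := s_all (g := idfun) (fun _ _ => erefl).
have sep : generically (fun t => forall i k, block i != block k -> (block i).[t] !=
  (block k).[t]).
  apply: generically_forall => i; apply: generically_forall => k.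
  have [->|ik] := eqVneq (block i) (block k); first exact: generically_all.
  have : block i - block k != 0 by rewrite subr_eq0.
  move/generically_neq0; apply: generically_imp => t.
  by rewrite hornerD hornerN subr_eq0.
have [c cP] := generically_nat char0 sep.
exists (block i0).[c%:R], (fun i => (block i).[c%:R]); split=> [g i gK gi|i k];
  last first.
  split=> [e|/eq_block -> //]; apply/eq_block; apply: contrapT => /eqP/cP.
  by rewrite e eqxx.
have [h [hK gh hg]] := fixes_inv subK algK gK.
have /choice[f fE] : forall k, exists l, g (s k alpha) = s l alpha.
  by move=> k; apply: (s_all (g := g \o s k)) => x Kx /=; rewrite (sK k Kx) gK.
have f_inj : injective f.
  by move=> k l e; apply: s_inj; apply: (fmorph_inj g); rewrite !fE e.
have fi0 : f i0 = i by apply: s_inj; rewrite -fE -gi -i0E.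
rewrite !horner_prod rmorph_prod [RHS](reindex_inj f_inj) /=.
apply: eq_big => [k|k _]; last by rewrite !hornerXsubC rmorphB rmorph_nat fE.
apply/eqP/eqP => [/(label_compat gK (fE k) (fE i0))|e]; first by rewrite fi0.
(* The inverse automorphism brings an equality of labels back. *)
by apply: (@label_compat h (f k) (f i0)) => //; rewrite -?fE ?gh // fi0.
Qed.

End BlockElement.

Lemma isomorphic_over_refl (F : fieldType) (K M : set F) : isomorphic_over K M M.
Proof. by exists id; split=> //; split=> // x Mx; exists x. Qed.

Theorem theorem4p3
  (F : closedFieldType) (K : set F)
  (hK : is_subfield K)
  (hKfg : finitely_generated_over_Q K)
  (hF : forall x : F, algebraic_over K x)
  (alpha : F) (n : nat)
  (halpha : ext_degree K (adjoin K alpha) n)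
  (N : nat) (C : set 'rV[F]_N) (phi : 'I_N -> {fraction {poly F}})
  (hC : defined_over K C)
  (hphi : birational_parametrization phi C)
  (hphi_alpha : forall j, ratfun_over (adjoin K alpha) (phi j))
  (Z U : set 'rV[F]_n)
  (hZ : witness_variety K alpha phi Z)
  (hU : irreducible_component Z U)
  (hUdim : has_dim U 1)
  (r : nat)
  (hr : curve_degree U r)
  (hrn : (r < n)%N) :
  exists gamma : F,
    [/\ adjoin K gamma `<=` adjoin K alpha,
        ext_degree K (adjoin K gamma) r,
        exists f1 f2 : F,
          [/\ adjoin K alpha f1, adjoin K alpha f2, f1 != 0
            & forall j,
                ratfun_over (adjoin K gamma) (reparam phi (affine_sub f1 f2) j)]
      & forall e1 e2 : F,
          algebraic_over K e1 -> algebraic_over K e2 -> e1 != 0 ->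
          let psi := reparam phi (affine_sub e1 e2) in
          let L := coef_field K psi in
          [/\ exists2 d, ext_degree K L d & (r <= d)%N,
              exists M : set F,
                [/\ is_subfield M, M `<=` L
                  & isomorphic_over K (adjoin K gamma) M],
              ext_degree K L r -> isomorphic_over K L (adjoin K gamma)
            & exists (M : set F) (e1' e2' : F),
                [/\ is_subfield M /\ isomorphic_over K (adjoin K gamma) M,
                    L e1', L e2', e1' != 0
                  & forall j, ratfun_over M (reparam psi (affine_sub e1' e2') j)]]].
Proof.
have [char0 _] := hKfg; have algK := hF; have subK := hK.
have [d0 [s0 [s0K s0_inj s0_all]]] := finite_orbit subK algK alpha.
have degA := orbit_ext_degree char0 subK algK s0K s0_inj s0_all.
(* The number of conjugates of alpha is the dimension of the space of the witness variety, so the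
   Vandermonde matrix of the conjugates is square. *)
have d0n : d0 = n by apply/eqP; rewrite eqn_leq (ext_degree_le subK degA halpha)
  (ext_degree_le subK halpha degA).
subst d0; rename s0 into s; rename s0K into sK; rename s0_inj into s_inj;
  rename s0_all into s_all.
have n0 : (0 < n)%N by apply: leq_ltn_trans hrn.
have [i0 /= i0E] := s_all idfun (fun _ _ => erefl).
have /choice[Phi PhiP] : forall j, exists R : {poly F} * {poly F},
    [/\ phi j = R.1%:F / R.2%:F, coprimep R.1 R.2 & R.2 \is monic].
  move=> j; have [p [q [_ _ q0 ->]]] := hphi_alpha j.
  by have [a [b ab]] := frac_reduced p q0; exists (a, b).
have phiE j : phi j = (Phi j).1%:F / (Phi j).2%:F by have [] := PhiP j.
have Phi_coprime j : coprimep (Phi j).1 (Phi j).2 by have [] := PhiP j.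
have Phi_neq0 j : (Phi j).2 != 0 by have [_ _ /monic_neq0] := PhiP j.
have subA := adjoin_subfield K alpha; have algA :=
  algebraic_over_sub algK (@sub_adjoin _ K alpha).
have Phi_alpha (g : {rmorphism F -> F}) : fixes K g -> g alpha = alpha ->
  conj_tuple g Phi = Phi.
  move=> gK ga; apply/funext => j; rewrite /conj_tuple [RHS]surjective_pairing.
  have := hphi_alpha j; rewrite phiE => /(ratfun_overP char0 subA algA _ (Phi_neq0 j)).
  move=> /(_ g (proj2 (fixes_adjoin K g alpha) (conj gK ga))).
  by have [_ _ mon] := PhiP j; move=> /(reduced_fixed (Phi_coprime j) mon)[-> ->].
have conj_agree (g h : {rmorphism F -> F}) : fixes K g -> fixes K h -> g alpha =
  h alpha ->
    conj_tuple g Phi = conj_tuple h Phi.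
  move=> gK hfix gh; have [h' [h'K hh' h'h]] := fixes_inv subK algK hfix.
  have kK : fixes K (h' \o g) by move=> x Kx /=; rewrite gK // h'K.
  have k_alpha : (h' \o g) alpha = alpha by rewrite /= gh hh'.
  rewrite -[in RHS](Phi_alpha _ kK k_alpha) -conj_tuple_comp.
  by apply: eq_conj_tuple => x /=; rewrite h'h.
have [P [Q [Q_neq0 PQ]]] := birational_pointwise char0 phiE Phi_coprime Phi_neq0 hphi.
have vanP (f : {mpoly F[N]}) := vanishing_ideal_param char0 phiE Phi_coprime Phi_neq0 f
  (proj1 hphi).
have ideal_conj (g : {rmorphism F -> F}) (f : {mpoly F[N]}) : fixes K g ->
    generically (fun t => f.@[value Phi t] = 0) ->
    generically (fun t => (map_mpoly g f).@[value Phi t] = 0).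
  by move=> gK /vanP fC; apply/vanP; apply: (vanishing_ideal_conj hC gK fC).
pose good t := Q.@[value Phi t] != 0 /\ (denominator Phi).[t] != 0.
have generically_good : generically good.
  exact: generically_and Q_neq0 (generically_Phi_neq0 Phi_neq0).
have good_inj t t' : good t -> good t' -> value Phi t =1 value Phi t' -> t = t'.
  by move=> [Qt Dt] [_ Dt']; apply: (value_injective PQ).
have /choice[mob mobP] : forall i, exists m : F * F * F * F, let: (a, b, c, d) := m in
    a * d - b * c != 0 /\ generically (fun t =>
    [/\ c * t + d != 0, (map_mpoly (s i) Q).@[value Phi t] != 0,
        (map_mpoly (s i) P).@[value Phi t] =
          (a * t + b) / (c * t + d) * (map_mpoly (s i) Q).@[value Phi t]
      & value (conj_tuple (s i) Phi) ((a * t + b) / (c * t + d)) =1 value Phi t]).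
  move=> i; have [a [b [c [d abcd]]]] :=
    conj_moebius char0 subK algK Phi_coprime Phi_neq0 Q_neq0 PQ ideal_conj (sK i).
  by exists (a, b, c, d).
pose a i := (mob i).1.1.1; pose b i := (mob i).1.1.2; pose c i := (mob i).1.2;
  pose d i := (mob i).2.
have [det moeb] : (forall i, a i * d i - b i * c i != 0) /\ forall i,
  generically (fun t =>
    [/\ c i * t + d i != 0, (map_mpoly (s i) Q).@[value Phi t] != 0,
        (map_mpoly (s i) P).@[value Phi t] =
          (a i * t + b i) / (c i * t + d i) * (map_mpoly (s i) Q).@[value Phi t]
      & value (conj_tuple (s i) Phi) ((a i * t + b i) / (c i * t + d i)) =1
        value Phi t]).
  by split=> i; have := mobP i; rewrite /a /b /c /d; case: (mob i) => [[[? ?] ?] ?] [].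
have moeb' i : generically (fun t => c i * t + d i != 0 /\
    value (conj_tuple (s i) Phi) ((a i * t + b i) / (c i * t + d i)) =1 value Phi t).
  by apply: generically_imp (moeb i) => t [].
have conj_i0 : conj_tuple (s i0) Phi = Phi by apply: Phi_alpha.
have ci0 : c i0 = 0
  by apply: (conj_i_pole_infinity char0 generically_good good_inj det moeb' conj_i0).
have [num [delta [[num_K delta_K] [delta0 _] num_eq ZE]]] := hZ.
have num_identity j (y : 'I_n -> F) : let u := \sum_(i < n) alpha ^+ i * y i in
    (Phi j).1.[u] * delta.@[y] = (\sum_(i < n) alpha ^+ i * (num i j).@[y]) *
      (Phi j).2.[u].
  apply: (@witness_identity F n alpha _ _ (fun i => num i j)) => //.
  by rewrite -phiE; apply: num_eq.
have [irrU UZ _] := hU.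
have U_curve := component_curve subK algK Phi_coprime Q_neq0 PQ sK s_inj conj_i0 det
  moeb
  num_K delta_K num_identity ZE irrU UZ (proj1 hUdim).
have r_poles : r = size (poles c d).
  by apply: curve_degree_poles U_curve hr => //;
    [exists i0|apply: orbit_Vandermonde_unit].
have relP i j := related_pole char0 subK algK generically_good good_inj sK det moeb' i
  j.
(* Conjugates of alpha are labelled by poles. Equality of labels is affine relatedness, which
   automorphisms over K preserve. *)
have [|gamma [gammas [gammaE gammasE]]] := @block_element _ K char0 subK algK _ alpha s
  sK s_inj s_all _ (pole c d).
  move=> g i k i' k' gK gi gk /relP/(affinely_related_conj subK algK gK).
  have gsK l : fixes K (g \o s l) by move=> x Kx /=; rewrite (sK l _ Kx) gK.
  by rewrite (conj_agree _ _ (gsK i) (sK i') gi) (conj_agree _ _ (gsK k) (sK k') gk) =>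
    /relP.
have gamma_i0 : gamma = gammas i0 by apply: (gammaE idfun).
(* The stabilizer of gamma consists of the automorphisms whose Moebius map is affine: the pole of
   [i0] is infinity. *)
have gamma_fix (g : {rmorphism F -> F}) : fixes K g ->
    g gamma = gamma <-> affinely_related (value Phi) (value (conj_tuple g Phi)).
  move=> gK; have [i gi] := s_all g gK.
  rewrite (gammaE g i gK gi) (conj_agree _ _ gK (sK i) gi) gamma_i0 gammasE.
  have := relP i0 i; rewrite conj_i0 => ->.
  by split=> /esym.
(* One index for each distinct pole; the corresponding automorphisms give every conjugate of gamma
   once, which makes its degree [r]. *)
have /choice[idx idxE] : forall l : 'I_r, exists i, pole c d i = nth None (poles c d) l.
  move=> l; have : nth None (poles c d) l \in poles c d by rewrite mem_nth // -r_poles.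
  by rewrite mem_undup => /mapP[i _ ->]; exists i.
pose sg l := s (idx l).
have sgE l : sg l gamma = gammas (idx l) by exact: gammaE (sK _) erefl.
have sgK l : fixes K (sg l) by apply: sK.
have sg_inj : injective (fun l => sg l gamma).
  move=> l l'; rewrite !sgE => /gammasE; rewrite !idxE => /eqP.
  by rewrite nth_uniq ?undup_uniq -?r_poles // => /eqP/val_inj.
have sg_all (g : {rmorphism F -> F}) : fixes K g -> exists l, g gamma = sg l gamma.
  move=> gK; have [i gi] := s_all g gK.
  have ip : pole c d i \in poles c d by rewrite mem_undup; apply/map_f/mem_enum.
  have lt : (index (pole c d i) (poles c d) < r)%N by rewrite r_poles index_mem.
  exists (Ordinal lt); rewrite sgE (gammaE g i) //; apply/gammasE.
  by rewrite idxE nth_index.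
have subG := adjoin_subfield K gamma; have KG := @sub_adjoin _ K gamma.
have gamma_alpha : adjoin K alpha gamma.
  apply: mem_adjoin_fixed => // g gK ga.
  by rewrite (gammaE g i0) // ga -i0E.
exists gamma; split.
- by apply: adjoin_min gamma_alpha => //; apply: sub_adjoin.
- exact: orbit_ext_degree sg_all.
- have [|||f1 [f2 [f1A f2A f10 fE]]] := affine_descent char0 subK algK generically_good
    good_inj
    (theta := alpha) (gamma := gamma).
  + by move=> g gK ga; rewrite Phi_alpha //; apply: generically_all.
  + by move=> g gK ga; apply: (fixes_adjoin K g alpha).2 => //.
  + by move=> g gK /(gamma_fix g gK).
  exists f1, f2; split=> //.
  have repE j := reparam_affine f2 j phiE Phi_neq0 f10.
  have nz j : (affine_tuple Phi f1 f2 j).2 != 0 by apply: comp_affine_neq0.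
  apply: (ratfun_over_value char0 algK repE nz subG KG).2 => g /fixes_adjoin[gK gg].
  apply: generically_imp (fE g gK gg) => t e.
  by rewrite conj_affine_tuple !value_affine_tuple.
move=> e1 e2 _ _ e10; set psi := reparam phi (affine_sub e1 e2); set L :=
  coef_field K psi.
have psiE j := reparam_affine e2 j phiE Phi_neq0 e10.
set Psi := affine_tuple Phi e1 e2 in psiE.
have Psi_neq0 j : (Psi j).2 != 0 by apply: comp_affine_neq0.
have [theta LE psi_theta] := coef_field_primitive char0 subK algK psiE Psi_neq0.
have subT := adjoin_subfield K theta; have KT := @sub_adjoin _ K theta.
have Psi_theta (g : {rmorphism F -> F}) : fixes K g -> g theta = theta ->
    generically (fun t => value (conj_tuple g Psi) t =1 value Psi t).
  move=> gK gt; apply: ((ratfun_over_value char0 algK psiE Psi_neq0 subT KT).1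
    psi_theta).
  exact/fixes_adjoin.
have PhiPsi : affinely_related (value Phi) (value Psi)
  by apply: affinely_related_affine_tuple.
have conj_PhiPsi (g : {rmorphism F -> F}) :
    affinely_related (value (conj_tuple g Phi)) (value (conj_tuple g Psi)).
  by rewrite conj_affine_tuple; apply: affinely_related_affine_tuple;
    rewrite fmorph_eq0.
(* [g] fixes the coefficients of the second parametrization, which differs from [Phi], and its
   conjugate from the conjugate of [Phi], by an affine substitution only. *)
have theta_gamma (g : {rmorphism F -> F}) : fixes K g -> g theta = theta -> g gamma =
  gamma.
  move=> gK gt; apply/(gamma_fix g gK); apply: (affinely_related_trans PhiPsi).
  apply: affinely_related_trans (affinely_related_sym (conj_PhiPsi g)).
  exact/affinely_related_eq/Psi_theta.
have gammaT : adjoin K theta gamma by apply: mem_adjoin_fixed.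
have [m [st [stK st_inj st_all]]] := finite_orbit subK algK theta.
have degT := orbit_ext_degree char0 subK algK stK st_inj st_all.
(* Since gamma is in K(theta), the image of theta under an automorphism determines that of gamma, so
   distinct conjugates of gamma give distinct conjugates of theta. *)
have /choice[f fE] : forall l, exists k, sg l theta = st k theta by move=> l;
  apply: st_all.
have f_inj : injective f.
  move=> l l' e; apply: sg_inj.
  by apply: (adjoin_agree subK algK _ _ _ gammaT) => //; rewrite !fE e.
have rm : (r <= m)%N by have := leq_card f f_inj; rewrite !card_ord.
have GT : adjoin K gamma `<=` adjoin K theta by apply: adjoin_min.
rewrite /L LE; split.
- by exists m.
- by exists (adjoin K gamma); split=> //; apply: isomorphic_over_refl.
- move=> degr; have mr : m = r by apply/eqP;
    rewrite eqn_leq rm (ext_degree_le subK degT degr).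
  (* With equal degrees [f] is a bijection: each conjugate of theta lies over a different conjugate
     of gamma, so an automorphism fixing gamma fixes theta. *)
  have thetaG : adjoin K gamma theta.
    apply: mem_adjoin_fixed => // g gK gg; subst m.
    have [k0 k0E] := st_all idfun (fun _ _ => erefl); have [k1 k1E] := st_all g gK.
    have fK := f_invF f_inj.
    rewrite k1E -[RHS]/(idfun theta) k0E -(fK k0) -(fK k1) -!fE.
    have [l0E l1E] : sg (invF f_inj k0) gamma = gamma /\ sg (invF f_inj k1) gamma =
      gamma.
      split; [rewrite -[RHS]/(idfun gamma)|rewrite -[RHS]gg];
        by apply: (adjoin_agree subK algK _ _ _ gammaT) => //; rewrite fE fK.
    by congr (sg _ _); apply: sg_inj; rewrite l0E l1E.
  have -> : adjoin K theta = adjoin K gamma.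
    by apply/seteqP; split=> //; apply: adjoin_min.
  exact: isomorphic_over_refl.
(* The averaging is repeated for the second parametrization with theta generating L, so that the new
   substitution has its coefficients in L. *)
pose goodP t := good (e1 * t + e2).
have [|||||e1' [e2' [e1T e2T e10' eE]]] := @affine_descent _ K char0 subK algK N Psi
  goodP _ _ theta gamma.
- exact: generically_affine.
- move=> t t' gt gt' e; have := good_inj _ _ gt gt'.
  by rewrite -!value_affine_tuple => /(_ e)/addIr/(mulfI e10).
- exact: Psi_theta.
- exact: theta_gamma.
- move=> g gK /(gamma_fix g gK) Phig.
  apply: (affinely_related_trans (affinely_related_sym PhiPsi)).
  exact: (affinely_related_trans Phig).
exists (adjoin K gamma), e1', e2'; split=> //.
  by split=> //; apply: isomorphic_over_refl.
have repE j := reparam_affine e2' j psiE Psi_neq0 e10'.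
have nz j : (affine_tuple Psi e1' e2' j).2 != 0 by apply: comp_affine_neq0.
apply: (ratfun_over_value char0 algK repE nz subG KG).2 => g /fixes_adjoin[gK gg].
apply: generically_imp (eE g gK gg) => t e.
by rewrite conj_affine_tuple (value_affine_tuple (conj_tuple g Psi))
  (value_affine_tuple Psi).
Qed.
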